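(* Let $(G,\omega,J,\nabla)$ be a special Kähler Lie group such that the metric $k(X,Y)=\omega(X,JY)$ is positive definite and $\nabla$ is bi-invariant. Then $G$ is nilpotent and its special Kähler Lie algebra is obtained as a double extension starting from $\{0\}$ (that is, by a finite series of double extensions of special Kähler Lie algebras starting from $\{0\}$). In particular, $\nabla J=0$.
   Context: Special Kähler Lie group: a connected Lie group $G$ with left invariant symplectic form $\omega$, integrable almost complex structure $J$ and flat torsion free connection $\nabla$ such that $k(X,Y)=\omega(X,JY)$ is a pseudo-Riemannian metric, $\nabla\omega=0$, and $(\nabla_XJ)Y=(\nabla_YJ)X$ for all vector fields $X,Y$. Its associated special Kähler Lie algebra is $(\mathfrak{g},\omega_\epsilon,J_\epsilon,\cdot)$ with $\epsilon$ the identity of $G$ and $x\cdot y=(\nabla_{x^+}y^+)(\epsilon)$, where $x^+$ is the left invariant vector field determined by $x\in\mathfrak{g}$. $\nabla$ is bi-invariant if it is invariant under both left and right translations. Special Kähler Lie algebra: a finite dimensional real Lie algebra with a non-degenerate scalar 2-cocycle $\omega$, an integrable complex structure $j$ and a left symmetric product $\cdot$ such that $k(x,y)=\omega(x,j(y))$ is symmetric and non-degenerate, $[x,y]=x\cdot y-y\cdot x$, $\omega(x\cdot y,z)+\omega(y,x\cdot z)=0$, and $j([x,y])=x\cdot j(y)-y\cdot j(x)$. Double extension: given a special Kähler Lie algebra $(B,\omega',j',\cdot)$ and $D\in\mathfrak{sp}(B,\omega')$ a derivation of $(B,\cdot)$ with $[D,j']=0$, the double extension of $B$ according to $D$ is the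 special Kähler Lie algebra on $\mathbb{R}e\oplus B\oplus\mathbb{R}d$ whose bracket extends that of $B$ with $e$ central and $[d,x]=D(x)$ for $x\in B$; whose symplectic form extends $\omega'$ with $\widetilde\omega(e,d)=1$ and $\mathrm{Vect}_{\mathbb{R}}\{e,d\}$ orthogonal to $B$; whose left symmetric product $\diamond$ extends that of $B$ with $d\diamond x=D(x)$ for $x\in B$ and all other products involving $e$ or $d$ equal to zero; and whose complex structure extends $j'$ with $\widetilde j(e)=d$. *)

(* Defs.v *)
From HB Require Import structures.
From mathcomp Require Import all_boot all_order all_algebra.
From mathcomp Require Import all_classical all_reals all_analysis.

Set Implicit Arguments.
Unset Strict Implicit.
Unset Printing Implicit Defensive.

Import Order.TTheory GRing.Theory Num.Theory.
Import numFieldNormedType.Exports.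

Local Open Scope classical_set_scope.
Local Open Scope ring_scope.

(** * Smooth functions between normed spaces *)

Section Smooth.
Context {R : realType} {V W : normedModType R}.

(* [f] is a total function, but only its values on the open set [U] matter. *)
Fixpoint Ck (k : nat) (U : set V) (f : V -> W) : Prop :=
  match k with
  | 0 => forall x, U x -> {for x, continuous f}
  | k'.+1 => (forall x, U x -> differentiable f x) /\
             (forall v, Ck k' U (fun x => 'd f x v))
  end.

Definition smooth_on (U : set V) (f : V -> W) : Prop := forall k, Ck k U f.

Definition smooth_at (x : V) (f : V -> W) : Prop :=
  exists2 U, open_nbhs x U & smooth_on U f.

End Smooth.

(** * Lie groups *)

#[short(type="groupTopologicalType")]
HB.structure Definition GroupTopological := {G of Group G & Topological G}.

Record chart (R : realType) (n : nat) (M : topologicalType) := Chart {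
  chart_dom : set M;
  chart_map : M -> 'rV[R]_n;
  chart_inv : 'rV[R]_n -> M;
  chart_dom_open : open chart_dom;
  chart_img_open : open (chart_map @` chart_dom);
  chart_mapK : forall x, chart_dom x -> chart_inv (chart_map x) = x;
  chart_map_continuous :
    forall x, chart_dom x -> {for x, continuous chart_map};
  chart_inv_continuous :
    forall u, (chart_map @` chart_dom) u -> {for u, continuous chart_inv}
}.

(* The atlas is indexed by the points of the group: [chart_at p] is a chart
   around [p]. No generality is lost, and the chart at [p] serves to identify
   the tangent space at [p] with R^n. *)
Record lieGroup (R : realType) (n : nat) := LieGroup {
  lie_sort :> groupTopologicalType;
  lie_hausdorff : hausdorff_space lie_sort;
  lie_second_countable : @second_countable lie_sort;
  chart_at : lie_sort -> chart R n lie_sort;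
  chart_at_dom : forall p, chart_dom (chart_at p) p;
  chart_at_compat : forall p q,
    smooth_on (chart_map (chart_at q) @`
                 (chart_dom (chart_at p) `&` chart_dom (chart_at q)))
              (chart_map (chart_at p) \o chart_inv (chart_at q));
  lie_mul_continuous :
    continuous (fun z : lie_sort * lie_sort => (z.1 * z.2)%g);
  lie_mul_smooth : forall g h : lie_sort,
    smooth_at (chart_map (chart_at g) g, chart_map (chart_at h) h)
      (fun z : 'rV[R]_n * 'rV[R]_n => chart_map (chart_at (g * h)%g)
         (chart_inv (chart_at g) z.1 * chart_inv (chart_at h) z.2)%g);
  lie_inv_continuous : continuous (fun g : lie_sort => (g^-1)%g);
  lie_inv_smooth : forall g : lie_sort,
    smooth_at (chart_map (chart_at g) g)
      (fun u => chart_map (chart_at (g^-1)%g)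
         (chart_inv (chart_at g) u)^-1%g)
}.

(** * Differential calculus on a Lie group *)

Section LieCalculus.
Context {R : realType} {n : nat} (G : lieGroup R n).
Implicit Types (p q g h : G) (f : G -> R).

(* A tangent vector at [p] is represented by its coordinates in the chart
   [chart_at p]; so a vector field is a map from [G] to R^n whose value at [p]
   is expressed in [chart_at p], and similarly for all tensor fields. *)
Local Notation TG := 'rV[R]_n.
Implicit Types (X Y Z : G -> TG).

Definition coord p : G -> TG := chart_map (chart_at p).
Definition coord_inv p : TG -> G := chart_inv (chart_at p).

Definition smooth_fun f : Prop :=
  forall p, smooth_at (coord p p) (f \o coord_inv p).

Definition tangent_map (F : G -> G) p : TG -> TG :=
  'd (coord (F p) \o F \o coord_inv p) (coord p p).

(* the expression of [X] in the chart [chart_at p]: the components of [X q],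
   given in [chart_at q], are transformed by the Jacobian of the transition *)
Definition local_rep p X (u : TG) : TG :=
  let q := coord_inv p u in
  'd (coord p \o coord_inv q) (coord q q) (X q).

Definition smooth_vf X : Prop :=
  forall p, smooth_at (coord p p) (local_rep p X).

Definition vf_apply X f : G -> R :=
  fun p => 'd (f \o coord_inv p : TG -> R) (coord p p) (X p).

Definition lie_bracket X Y : G -> TG := fun p =>
  'd (local_rep p Y) (coord p p) (X p) - 'd (local_rep p X) (coord p p) (Y p).

(* [Finv] is the inverse of the diffeomorphism [F] *)
Definition pushforward (F Finv : G -> G) X : G -> TG :=
  fun q => tangent_map F (Finv q) (X (Finv q)).

Definition ltrans h : G -> G := fun g => (h * g)%g.
Definition rtrans h : G -> G := fun g => (g * h)%g.

Definition left_invariant_vf (x : TG) : G -> TG :=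
  fun g => tangent_map (ltrans g) 1%g x.

(** Tensor fields and connections *)

Implicit Types (omega : G -> TG -> TG -> R) (J : G -> TG -> TG)
  (nabla : (G -> TG) -> (G -> TG) -> (G -> TG)).

Definition eval2 omega X Y : G -> R := fun p => omega p (X p) (Y p).
Definition eval1 J X : G -> TG := fun p => J p (X p).

Record is_symplectic_form omega : Prop := {
  sympl_linl : forall p v, scalar (omega p ^~ v);
  sympl_linr : forall p u, scalar (omega p u);
  sympl_alt : forall p u, omega p u u = 0;
  sympl_smooth : forall X Y, smooth_vf X -> smooth_vf Y ->
    smooth_fun (eval2 omega X Y);
  sympl_nondeg : forall p u, (forall v, omega p u v = 0) -> u = 0;
  sympl_closed : forall X Y Z, smooth_vf X -> smooth_vf Y -> smooth_vf Z ->
    forall p,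
      vf_apply X (eval2 omega Y Z) p + vf_apply Y (eval2 omega Z X) p
      + vf_apply Z (eval2 omega X Y) p
      - eval2 omega (lie_bracket X Y) Z p - eval2 omega (lie_bracket Y Z) X p
      - eval2 omega (lie_bracket Z X) Y p = 0
}.

Record is_integrable_complex_structure J : Prop := {
  cplx_lin : forall p, linear (J p);
  cplx_smooth : forall X, smooth_vf X -> smooth_vf (eval1 J X);
  cplx_sqr : forall p u, J p (J p u) = - u;
  cplx_nijenhuis : forall X Y, smooth_vf X -> smooth_vf Y -> forall p,
    lie_bracket (eval1 J X) (eval1 J Y) p
    - J p (lie_bracket (eval1 J X) Y p) - J p (lie_bracket X (eval1 J Y) p)
    - lie_bracket X Y p = 0
}.

(* A connection is only meaningful on smooth vector fields. *)
Record is_connection nabla : Prop := {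
  conn_smooth : forall X Y, smooth_vf X -> smooth_vf Y ->
    smooth_vf (nabla X Y);
  conn_addl : forall X X' Y, smooth_vf X -> smooth_vf X' -> smooth_vf Y ->
    forall p, nabla (fun q => X q + X' q) Y p = nabla X Y p + nabla X' Y p;
  conn_tensorial : forall f X Y, smooth_fun f -> smooth_vf X -> smooth_vf Y ->
    forall p, nabla (fun q => f q *: X q) Y p = f p *: nabla X Y p;
  conn_addr : forall X Y Y', smooth_vf X -> smooth_vf Y -> smooth_vf Y' ->
    forall p, nabla X (fun q => Y q + Y' q) p = nabla X Y p + nabla X Y' p;
  conn_leibniz : forall f X Y, smooth_fun f -> smooth_vf X -> smooth_vf Y ->
    forall p, nabla X (fun q => f q *: Y q) p =
      vf_apply X f p *: Y p + f p *: nabla X Y p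
}.

Definition torsion_free nabla : Prop :=
  forall X Y, smooth_vf X -> smooth_vf Y -> forall p,
    nabla X Y p - nabla Y X p = lie_bracket X Y p.

Definition flat nabla : Prop :=
  forall X Y Z, smooth_vf X -> smooth_vf Y -> smooth_vf Z -> forall p,
    nabla X (nabla Y Z) p - nabla Y (nabla X Z) p
    - nabla (lie_bracket X Y) Z p = 0.

Definition form_left_invariant omega : Prop := forall h g u v,
  omega (h * g)%g (tangent_map (ltrans h) g u) (tangent_map (ltrans h) g v)
  = omega g u v.

Definition endo_left_invariant J : Prop := forall h g u,
  J (h * g)%g (tangent_map (ltrans h) g u) = tangent_map (ltrans h) g (J g u).

Definition conn_left_invariant nabla : Prop :=
  forall h X Y, smooth_vf X -> smooth_vf Y -> forall p,
    let L := pushforward (ltrans h) (ltrans h^-1%g) in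
    L (nabla X Y) p = nabla (L X) (L Y) p.

Definition conn_right_invariant nabla : Prop :=
  forall h X Y, smooth_vf X -> smooth_vf Y -> forall p,
    let T := pushforward (rtrans h) (rtrans h^-1%g) in
    T (nabla X Y) p = nabla (T X) (T Y) p.

Definition bi_invariant nabla : Prop :=
  conn_left_invariant nabla /\ conn_right_invariant nabla.

Definition nabla_endo nabla J X Y : G -> TG :=
  fun p => nabla X (eval1 J Y) p - J p (nabla X Y p).

Definition metric omega J : G -> TG -> TG -> R :=
  fun p u v => omega p u (J p v).

Record is_special_kahler_lie_group omega J nabla : Prop := {
  sk_connected : connected [set: G];
  sk_symplectic : is_symplectic_form omega;
  sk_complex : is_integrable_complex_structure J;
  sk_connection : is_connection nabla;
  sk_form_left_invariant : form_left_invariant omega;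
  sk_endo_left_invariant : endo_left_invariant J;
  sk_conn_left_invariant : conn_left_invariant nabla;
  sk_flat : flat nabla;
  sk_torsion_free : torsion_free nabla;
  sk_metric_sym : forall p u v, metric omega J p u v = metric omega J p v u;
  sk_metric_nondeg : forall p u,
    (forall v, metric omega J p u v = 0) -> u = 0;
  sk_nabla_form : forall X Y Z, smooth_vf X -> smooth_vf Y -> smooth_vf Z ->
    forall p, vf_apply X (eval2 omega Y Z) p =
      eval2 omega (nabla X Y) Z p + eval2 omega Y (nabla X Z) p;
  sk_nabla_endo : forall X Y, smooth_vf X -> smooth_vf Y ->
    forall p, nabla_endo nabla J X Y p = nabla_endo nabla J Y X p
}.

Definition metric_positive_definite omega J : Prop :=
  forall p u, u != 0 -> 0 < metric omega J p u u.

Definition endo_parallel nabla J : Prop :=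
  forall X Y, smooth_vf X -> smooth_vf Y ->
    forall p, nabla_endo nabla J X Y p = 0.

End LieCalculus.
Arguments left_invariant_vf {R n} G x _.

(** * Nilpotent groups *)

Section Nilpotent.
Context (G : groupType).

Definition is_subgroup (H : set G) : Prop :=
  [/\ H 1%g, forall x y, H x -> H y -> H (x * y)%g
    & forall x, H x -> H x^-1%g].

Fixpoint lower_central_series (k : nat) : set G :=
  match k with
  | 0 => [set: G]
  | k'.+1 => smallest is_subgroup
      [set z | exists2 x, lower_central_series k' x & exists y, z = commg x y]
  end.

Definition nilpotent_group : Prop :=
  exists k, lower_central_series k = [set 1%g].

End Nilpotent.

(** * Special Kähler Lie algebras and double extensions *)

Record skAlgebra (R : realType) := SkAlgebra {
  sk_sort :> vectType R;
  sk_br : sk_sort -> sk_sort -> sk_sort;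
  sk_form : sk_sort -> sk_sort -> R;
  sk_j : sk_sort -> sk_sort;
  sk_mul : sk_sort -> sk_sort -> sk_sort
}.
Arguments sk_br {R s}.
Arguments sk_form {R s}.
Arguments sk_j {R s}.
Arguments sk_mul {R s}.

Record is_special_kahler_algebra (R : realType) (A : skAlgebra R) : Prop := {
  ska_br_linl : forall y : A, linear (sk_br ^~ y);
  ska_br_linr : forall x : A, linear (sk_br x);
  ska_br_alt : forall x : A, sk_br x x = 0;
  ska_jacobi : forall x y z : A,
    sk_br x (sk_br y z) + sk_br y (sk_br z x) + sk_br z (sk_br x y) = 0;
  ska_form_linl : forall y : A, scalar (sk_form ^~ y);
  ska_form_linr : forall x : A, scalar (sk_form x);
  ska_form_alt : forall x : A, sk_form x x = 0;
  ska_form_nondeg : forall x : A, (forall y, sk_form x y = 0) -> x = 0;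
  ska_form_cocycle : forall x y z : A,
    sk_form (sk_br x y) z + sk_form (sk_br y z) x + sk_form (sk_br z x) y = 0;
  ska_j_lin : linear (sk_j : A -> A);
  ska_j_sqr : forall x : A, sk_j (sk_j x) = - x;
  ska_j_nijenhuis : forall x y : A,
    sk_br (sk_j x) (sk_j y) - sk_j (sk_br (sk_j x) y)
    - sk_j (sk_br x (sk_j y)) - sk_br x y = 0;
  ska_mul_linl : forall y : A, linear (sk_mul ^~ y);
  ska_mul_linr : forall x : A, linear (sk_mul x);
  ska_left_symmetric : forall x y z : A,
    sk_mul (sk_mul x y) z - sk_mul x (sk_mul y z) =
    sk_mul (sk_mul y x) z - sk_mul y (sk_mul x z);
  ska_metric_sym : forall x y : A, sk_form x (sk_j y) = sk_form y (sk_j x);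
  ska_metric_nondeg : forall x : A,
    (forall y, sk_form x (sk_j y) = 0) -> x = 0;
  ska_br_mul : forall x y : A, sk_br x y = sk_mul x y - sk_mul y x;
  ska_form_mul : forall x y z : A,
    sk_form (sk_mul x y) z + sk_form y (sk_mul x z) = 0;
  ska_j_br : forall x y : A,
    sk_j (sk_br x y) = sk_mul x (sk_j y) - sk_mul y (sk_j x)
}.

Definition lie_group_algebra (R : realType) (n : nat) (G : lieGroup R n)
    (omega : G -> 'rV[R]_n -> 'rV[R]_n -> R) (J : G -> 'rV[R]_n -> 'rV[R]_n)
    (nabla : (G -> 'rV[R]_n) -> (G -> 'rV[R]_n) -> (G -> 'rV[R]_n)) :
    skAlgebra R :=
  @SkAlgebra R 'rV[R]_n
    (fun x y => lie_bracket (left_invariant_vf G x) (left_invariant_vf G y) 1%g)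
    (omega 1%g)
    (J 1%g)
    (fun x y => nabla (left_invariant_vf G x) (left_invariant_vf G y) 1%g).

Record double_ext_admissible (R : realType) (B : skAlgebra R) (D : B -> B) :
    Prop := {
  dea_lin : linear D;
  dea_sp : forall x y, sk_form (D x) y + sk_form x (D y) = 0;
  dea_der : forall x y, D (sk_mul x y) = sk_mul (D x) y + sk_mul x (D y);
  dea_comm : forall x, D (sk_j x) = sk_j (D x)
}.

(* [(a, x, b)] stands for [a e + x + b d]; [j e = d] forces [j d = - e] *)
Definition double_ext (R : realType) (B : skAlgebra R) (D : B -> B) :
    skAlgebra R :=
  @SkAlgebra R (R^o * B * R^o)%type
    (fun s t => let: (_, x, b) := s in let: (_, y, b') := t in
       (0, sk_br x y + b *: D y - b' *: D x, 0))
    (fun s t => let: (a, x, b) := s in let: (a', y, b') := t in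
       sk_form x y + (a * b' - b * a'))
    (fun s => let: (a, x, b) := s in (- b, sk_j x, a))
    (fun s t => let: (_, x, b) := s in let: (_, y, _) := t in
       (0, sk_mul x y + b *: D y, 0)).

Definition sk_isomorphic (R : realType) (A A' : skAlgebra R) : Prop :=
  exists f : A -> A',
    [/\ linear f, bijective f,
        forall x y, f (sk_br x y) = sk_br (f x) (f y) &
        [/\ forall x y, sk_form (f x) (f y) = sk_form x y,
            forall x, f (sk_j x) = sk_j (f x) &
            forall x y, f (sk_mul x y) = sk_mul (f x) (f y)]].

Inductive iterated_double_ext (R : realType) : skAlgebra R -> Prop :=
| Ide_zero (A : skAlgebra R) :
    is_special_kahler_algebra A -> (forall x : A, x = 0) ->
    iterated_double_ext A
| Ide_step (B : skAlgebra R) (D : B -> B) (A : skAlgebra R) :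
    is_special_kahler_algebra B -> iterated_double_ext B ->
    double_ext_admissible D -> sk_isomorphic (double_ext D) A ->
    iterated_double_ext A.

(* Main.v *)
From HB Require Import structures.
From Pilot Require Import Defs.
From mathcomp Require Import all_boot all_order all_algebra.
From mathcomp Require Import all_classical all_reals all_analysis.
From mathcomp Require Import ring lra.

Set Implicit Arguments.
Unset Strict Implicit.
Unset Printing Implicit Defensive.

Import Order.TTheory GRing.Theory Num.Theory.
Import numFieldNormedType.Exports.
(* [coord] is the chart of a Lie group, not the coordinates of a vector space *)
Import Pilot.Defs.

Local Open Scope classical_set_scope.
Local Open Scope ring_scope.

(** Write [x+] and [x-] for the left and right invariant fields with value [x] at
    the identity, and [x.y] for the value of [nabla_(x+) y+] there. The theorem
    holds because the hypotheses are rigid: they force [x.y = 0] for all [x], [y].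

    The product is associative. Left and right invariant fields commute
    ([lie_bracket_left_right]), which is the symmetry of the second derivative of
    the map sending [w] and [v] to [w p v]. Hence [nabla_(z+) x- = nabla_(x-) z+],
    as there is no torsion, and right invariance gives [nabla_(x-) y- = (y.x)-].
    Flatness for the commuting fields [z+] and [x-] then reads
    [(y.x).z = y.(x.z)] ([product_assoc]); the adjoint representation is never
    differentiated.

    The product is zero ([product_vanishes]). As [nabla omega = 0], left
    multiplications are skew for [omega], so taking adjoints in
    [L_(x.y) = L_x L_y] gives [L_x L_y = - L_y L_x], whence [L_x L_y L_z = 0].
    If [p] is annihilated on both sides, the symmetry of [nabla J] gives
    [x.(J p) = 0], so that [omega (p, J (x.z)) = omega (x.z, J p) = 0]: thus [p] is
    orthogonal to all products. As the metric is definite, the products annihilated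
    on both sides are zero; this applies to [x.(y.z)], then to [x.y].

    It follows that left invariant fields are parallel. So are then right
    invariant ones, and the pairings [omega (x-, z+)] are constant on the
    connected group: [x- = x+]. Hence the map sending [h] to [h^-1 g h] has zero
    differential, and the group is commutative ([group_commutative]). In a
    parallel frame preserved by [J], the equality [nabla J = 0] is clear. The Lie
    algebra is a Hermitian space with zero product, which is built by adding
    complex lines one at a time: these are double extensions with [D = 0]
    ([flat_iterated_double_ext]). *)

(** * Differentials and mixed second derivatives *)

Section Differentials.
Context {R : realType}.
Implicit Types (U V W : normedModType R).

Lemma diff_remainder V W (f : V -> W) x : differentiable f x ->
  forall e, 0 < e ->
    \forall h \near 0, `|f (h + x) - f x - 'd f x h| <= e * `|h|.
Proof.
move=> /diff_locally /eqaddoP fx e e0; have := fx e e0.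
by apply: filterS => h; rewrite /= !fctE /= opprD addrA.
Qed.

(** Charts only give local formulas, so differentials are constantly transported
    along equalities that hold near a point. *)
Lemma near_eq_is_diff V W (f g : V -> W) x (df : V -> W) :
  (\near x, f x = g x) -> is_diff x f df -> is_diff x g df.
Proof.
move=> fg [fd dfE].
have fgx : f x = g x := nbhs_singleton fg.
have fg0 : \forall h \near 0, f (h + x) = g (h + x).
  by have := fg; rewrite (near_shift 0 x) subr0.
have gE : g \o shift x = cst (g x) + 'd f x +o_ 0 id.
  apply/eqaddoP => e e0; have := diff_remainder fd e0.
  apply: filterS2 fg0 => h fgh /=.
  by rewrite !fctE /= fgh fgx opprD addrA.
have gdE := diff_unique (diff_continuous fd) gE.
split; last by rewrite gdE.
apply/diff_locallyP; rewrite gdE; split=> //.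
exact: diff_continuous.
Qed.

(** The chain rule with the intermediate point up to equality: in practice [y] is
    [coord p p] and [f x] reduces to it by a rewriting only. *)
Lemma is_diff_chain U V W (f : U -> V) (g : V -> W) x y df dg :
  f x = y -> is_diff x f df -> is_diff y g dg -> is_diff x (g \o f) (dg \o df).
Proof. by move=> <- fd gd; exact: is_diff_comp. Qed.

Lemma is_diff_is_derive V W (f : V -> W) x v (df : V -> W) :
  is_diff x f df -> is_derive x v f (df v).
Proof.
move=> [fd <-]; apply: DeriveDef; first exact: diff_derivable.
by rewrite deriveE.
Qed.

Lemma is_diff_entry V n (f : V -> 'rV[R]_n) x df (i : 'I_n) :
  is_diff x f df -> is_diff x (fun y => f y 0 i : R) (fun v => df v 0 i : R).
Proof.
have @l : {linear 'rV[R]_n -> R}.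
  by exists (fun N : 'rV[R]_n => N 0 i); do 2![eexists]; do ?[constructor];
     rewrite ?mxE// => ? *; rewrite ?mxE//; move=> ?; rewrite !mxE.
move=> fd.
have ld : is_diff (f x) (l : 'rV[R]_n -> R) (l : 'rV[R]_n -> R).
  split; first exact/linear_differentiable/coord_continuous.
  exact/diff_lin/coord_continuous.
exact: (is_diff_comp fd ld).
Qed.

(** Mean value theorem for the restriction of [f] to a line. *)
Lemma zero_diff_segment V (f : V -> R) a v :
  (forall t : R, 0 <= t <= 1 -> is_diff (a + t *: v) f (0 : V -> R)) ->
  f (a + v) = f a.
Proof.
move=> f0.
have lined (t : R) : is_diff t (fun t : R => a + t *: v) (fun s : R => s *: v).
  have -> : (fun t : R => a + t *: v) = cst a + *:%R ^~ v by [].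
  by apply: is_diff_eq; rewrite add0r.
have fd (t : R) : 0 <= t <= 1 -> is_derive t 1 (fun t : R => f (a + t *: v)) 0.
  move=> /f0 fd0.
  have := is_diff_is_derive (1 : R) (is_diff_chain erefl (lined t) fd0).
  by move=> H; apply: (is_derive_eq H).
have [| |c _] := @MVT R (fun t => f (a + t *: v)) (cst 0) 0 1 ltr01.
- by move=> t; rewrite in_itv /= => /andP[/ltW ? /ltW ?]; apply: fd; apply/andP.
- apply: derivable_within_continuous => t; rewrite in_itv /= => t01.
  by case: (fd t t01).
by rewrite /= mul0r scale1r scale0r addr0 => /eqP; rewrite subr_eq0 => /eqP.
Qed.

Lemma zero_diff_near_cst V (f : V -> R) a :
  (\forall y \near a, is_diff y f (0 : V -> R)) -> \forall y \near a, f y = f a.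
Proof.
move=> /nbhs_ballP[e e0 fe]; apply/nbhs_ballP; exists e => // y aye.
rewrite -[y](subrK a) addrC; apply: zero_diff_segment => t /andP[t0 t1].
apply: fe; move: aye; rewrite -ball_normE /= opprD addNKr normrN distrC normrZ.
by apply: le_lt_trans; rewrite ger0_norm // ler_piMl.
Qed.

Lemma zero_diff_near_cst_row V n (f : V -> 'rV[R]_n) a :
  (\forall y \near a, is_diff y f (0 : V -> 'rV[R]_n)) ->
  \forall y \near a, f y = f a.
Proof.
move=> fe.
have fi i : \forall y \near a, f y 0 i = f a 0 i.
  apply: (@zero_diff_near_cst _ (fun y => f y 0 i)).
  apply: filterS fe => y /is_diff_entry -/(_ i) fd; apply: is_diff_eq fd _.
  by rewrite funeqE => v /=; rewrite mxE.
have : \forall y \near a, forall i, f y 0 i = f a 0 i by exact: filter_forall.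
by apply: filterS => y fy; apply/rowP => i.
Qed.

Definition second_difference V (f : V -> R) a x z (t : R) :=
  f (a + t *: x + t *: z) - f (a + t *: x) - f (a + t *: z) + f a.

Lemma second_differenceC V (f : V -> R) a x z t :
  second_difference f a z x t = second_difference f a x z t.
Proof. by rewrite /second_difference (addrAC a) [X in X + f a]addrAC. Qed.

(** The mean value theorem applied to [s |-> f (a + s x + t z) - f (a + s x)],
    followed by the first-order expansion of [g] at [a] at two points whose
    difference is [t z]. *)
Lemma second_difference_estimate V (f g : V -> R) a x z :
  (\forall y \near a, differentiable f y /\ 'd f y x = g y) -> differentiable g a ->
  forall e, 0 < e -> \forall t \near (0 : R), 0 < t ->
   `|second_difference f a x z t - t * (t * 'd g a z)|
     <= t * (e * (t * (2 * `|x| + `|z|))).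
Proof.
move=> fg gd e e0.
have near_both : \forall h \near (0 : V),
    (differentiable f (h + a) /\ 'd f (h + a) x = g (h + a)) /\
    `|g (h + a) - g a - 'd g a h| <= e * `|h|.
  apply: filterS2 (diff_remainder gd e0); last first.
    by have := fg; rewrite (near_shift 0 a) subr0; exact.
  by move=> h /= ? ?; split.
have /nbhs_ballP[d /= d0 dP] := near_both.
(* for [t < d / M], all the points [s x + r z] with [s, r <= t] are in the ball *)
pose M := `|x| + `|z| + 1.
have M0 : 0 < M by rewrite ltr_wpDl // addr_ge0.
apply/nbhs_ballP; exists (d / M); first exact: divr_gt0.
move=> t; rewrite -ball_normE /= sub0r normrN => td t0.
rewrite gtr0_norm // ltr_pdivlMr // in td.
have small (s r : R) : 0 <= s <= t -> 0 <= r <= t ->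
    `|s *: x + r *: z| <= s * `|x| + r * `|z| /\ ball 0 d (s *: x + r *: z).
  move=> /andP[s0 st] /andP[r0 rt].
  have le : `|s *: x + r *: z| <= s * `|x| + r * `|z|.
    by rewrite (le_trans (ler_normD _ _)) // !normrZ !ger0_norm.
  split=> //; rewrite -ball_normE /= sub0r normrN (le_lt_trans le) //.
  rewrite (le_lt_trans _ td) // /M.
  have := ler_wpM2r (normr_ge0 x) st; have := ler_wpM2r (normr_ge0 z) rt.
  lra.
pose phi (s : R) := f (a + s *: x + t *: z) - f (a + s *: x).
pose dphi (s : R) := g (a + s *: x + t *: z) - g (a + s *: x).
have t01 : 0 <= t <= t by rewrite ltW /=.
have z01 : (0 : R) <= 0 <= t by rewrite lexx ltW.
have derive_line (s r : R) : 0 <= s <= t -> 0 <= r <= t ->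
    is_derive s 1 (fun s => f (a + s *: x + r *: z)) (g (a + s *: x + r *: z)).
  move=> s01 r01; have [_ /dP[/= + _]] := small s r s01 r01.
  rewrite addrC addrA => -[fdv fdE].
  have lined : is_diff s (fun s : R => a + s *: x + r *: z) (fun u : R => u *: x).
    have -> : (fun s : R => a + s *: x + r *: z) = cst a + *:%R ^~ x + cst (r *: z).
      by [].
    by apply: is_diff_eq; rewrite add0r addr0.
  have := is_diff_is_derive (1 : R) (is_diff_chain erefl lined (differentiableP fdv)).
  by move=> /is_derive_eq; apply; rewrite /= scale1r.
have phid (s : R) : 0 <= s <= t -> is_derive s 1 phi (dphi s).
  move=> s01; have := derive_line s t s01 t01; have := derive_line s 0 s01 z01.
  under eq_fun do rewrite scale0r addr0.
  by rewrite scale0r addr0 => d2 d1; exact: is_deriveB.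
have [| |c c01] := @MVT R phi dphi 0 t t0.
- by move=> s; rewrite in_itv /= => /andP[/ltW ? /ltW ?]; apply: phid; apply/andP.
- apply: derivable_within_continuous => s; rewrite in_itv /= => s01.
  by case: (phid s s01).
move: c01; rewrite in_itv /= => /andP[/ltW c0 /ltW ct]; rewrite subr0 => phiE.
have c01 : 0 <= c <= t by rewrite c0.
have -> : second_difference f a x z t = t * dphi c.
  rewrite mulrC -phiE /phi /second_difference !scale0r !addr0 opprB addrA.
  ring.
rewrite -mulrBr normrM gtr0_norm // ler_pM2l //.
have [l1 /dP[_ /= e1]] := small c t c01 t01.
have [l2 /dP[_ /= e2]] := small c 0 c01 z01.
rewrite scale0r addr0 mul0r addr0 in l2 e2.
have dtz : 'd g a (t *: z) = t *: 'd g a z by rewrite linearZ.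
rewrite linearD dtz in e1.
have -> : dphi c - t * 'd g a z =
   (g (c *: x + t *: z + a) - g a - ('d g a (c *: x) + t *: 'd g a z))
   - (g (c *: x + a) - g a - 'd g a (c *: x)).
  rewrite /dphi -(addrA a) !(addrC a) -[t *: 'd g a z]/(t * _).
  ring.
rewrite (le_trans (ler_normB _ _)) // (le_trans (lerD e1 e2)) //.
rewrite -mulrDr ler_pM2l // (le_trans (lerD l1 l2)) //.
have := ler_wpM2r (normr_ge0 x) ct; lra.
Qed.

(** Young's form of the symmetry of second derivatives: both mixed derivatives
    are the limit of the second difference divided by [t ^+ 2]. The two
    first derivatives are assumed differentiable at [a] only, which the chain
    rule provides for composite maps. *)
Lemma mixed_derivatives_eq V n (f g h : V -> 'rV[R]_n) a x z :
  (\forall y \near a, differentiable f y) ->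
  (\forall y \near a, 'd f y x = g y) -> (\forall y \near a, 'd f y z = h y) ->
  differentiable g a -> differentiable h a ->
  'd g a z = 'd h a x.
Proof.
move=> fd fg fh /differentiableP gd /differentiableP hd; apply/rowP => i.
have [gid giE] := is_diff_entry i gd; have [hid hiE] := is_diff_entry i hd.
have fgi : \forall y \near a, differentiable (fun y => f y 0 i : R) y /\
    'd (fun y => f y 0 i : R) y x = g y 0 i.
  by apply: filterS2 fd fg => y /differentiableP/is_diff_entry-/(_ i)[? ->] <-.
have fhi : \forall y \near a, differentiable (fun y => f y 0 i : R) y /\
    'd (fun y => f y 0 i : R) y z = h y 0 i.
  by apply: filterS2 fd fh => y /differentiableP/is_diff_entry-/(_ i)[? ->] <-.
apply/eqP; rewrite -subr_eq0 -normr_le0; apply/ler_addgt0Pr => e e0; rewrite add0r.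
(* the two estimates below will add up to [t * t * (e / M * (M - 1))] *)
pose M := 3 * (`|x| + `|z|) + 1.
have M0 : 0 < M by rewrite ltr_wpDl // mulr_ge0 // addr_ge0.
have eM : 0 < e / M by rewrite divr_gt0.
have [t [t0 g_est h_est]] : exists t : R, [/\ 0 < t,
   `|second_difference (fun y => f y 0 i) a x z t - t * (t * 'd g a z 0 i)|
     <= t * (e / M * (t * (2 * `|x| + `|z|))) &
   `|second_difference (fun y => f y 0 i) a x z t - t * (t * 'd h a x 0 i)|
     <= t * (e / M * (t * (2 * `|z| + `|x|)))].
  have gnear := second_difference_estimate z fgi gid eM.
  have hnear := second_difference_estimate x fhi hid eM.
  have [d /= d0 dP] := (nbhs_ballP (0 : R) _).1 (filterI gnear hnear).
  have dt : ball (0 : R) d (d / 2).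
    by rewrite -ball_normE /= sub0r normrN gtr0_norm ?divr_gt0 // ltr_pdivrMr ?ltr_pMr // ltr1n.
  have t0 : 0 < d / 2 by rewrite divr_gt0.
  have [/(_ t0) e1 /(_ t0) e2] := dP _ dt; exists (d / 2); split=> //.
    by move: e1; rewrite giE.
  by move: e2; rewrite second_differenceC hiE.
have t2 : 0 < t * t by rewrite mulr_gt0.
suff : `|t * t * ('d g a z 0 i - 'd h a x 0 i)| <= t * t * e.
  by rewrite normrM (gtr0_norm t2) ler_pM2l.
have -> : t * t * ('d g a z 0 i - 'd h a x 0 i) =
  (second_difference (fun y => f y 0 i) a x z t - t * (t * 'd h a x 0 i)) -
  (second_difference (fun y => f y 0 i) a x z t - t * (t * 'd g a z 0 i)) by ring.
rewrite (le_trans (ler_normB _ _)) // (le_trans (lerD h_est g_est)) //.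
have -> : t * (e / M * (t * (2 * `|z| + `|x|))) +
   t * (e / M * (t * (2 * `|x| + `|z|))) = t * t * (e / M * (M - 1)).
  rewrite /M; ring.
rewrite ler_pM2l // -{2}(divfK (lt0r_neq0 M0) e) ler_pM2l // gerBl //.
Qed.

End Differentials.

(** * Smooth maps *)

Section Smoothness.
Context {R : realType}.
Implicit Types (V W : normedModType R).

(** The product rule, through the differential of the bilinear map [a, v |-> a *: v]. *)
Lemma is_diff_scale V W (f df : V -> R) (X dX : V -> W) x :
  is_diff x f df -> is_diff x X dX ->
  is_diff x (fun y => f y *: X y) (fun v => df v *: X x + f x *: dX v).
Proof.
have bil : bilinear_for (GRing.Scale.Law.clone _ _ *:%R _)
    (GRing.Scale.Law.clone _ _ *:%R _) (fun (a : R) (v : W) => a *: v).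
  split=> [v|a] c u w /=; first by rewrite scalerDl scalerA.
  by rewrite scalerDr !scalerA mulrC.
pose scM := bilinear_isBilinear.Build R R W W _ _ _ bil.
pose sc : {bilinear R -> W -> W} := HB.pack (fun (a : R) (v : W) => a *: v) scM.
have scd p : is_diff p (fun q : R * W => q.1 *: q.2)
    (fun q => p.1 *: q.2 + q.1 *: p.2).
  have sc_cont : continuous (fun q : R * W => sc q.1 q.2).
    by move=> q; exact: scale_continuous.
  split; first exact: (@differentiable_bilin R R W W sc p sc_cont).
  exact: (@diff_bilin R R W W sc p sc_cont).
move=> fd Xd; have fXd := is_diff_pair fd Xd.
apply: is_diff_eq (is_diff_comp fXd (scd _)) _.
by apply/funext => v /=; rewrite addrC.
Qed.

Lemma Ck_subset V W k (U U' : set V) (f : V -> W) :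
  U' `<=` U -> Ck k U f -> Ck k U' f.
Proof.
move=> U'U; elim: k f => [|k IH] f /= => [fc x /U'U/fc //|[fd dfC]].
by split=> [x /U'U/fd|v]; last exact: IH.
Qed.

Lemma Ck_ext V W k (U : set V) (f g : V -> W) :
  open U -> (forall x, U x -> f x = g x) -> Ck k U f -> Ck k U g.
Proof.
move=> oU; elim: k f g => [|k IH] f g fg /= => [fc x Ux|[fd dfC]].
  have fgx : \near x, f x = g x.
    by have := open_nbhs_nbhs (conj oU Ux); apply: filterS.
  rewrite /prop_for /continuous_at -(fg _ Ux); apply: cvg_trans (fc x Ux).
  exact: near_eq_cvg.
have gd x : U x -> is_diff x g ('d f x).
  move=> Ux; apply: near_eq_is_diff (differentiableP (fd x Ux)).
  by have := open_nbhs_nbhs (conj oU Ux); apply: filterS.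
split=> [x /gd[] //|v]; apply: IH (dfC v) => x /gd[_ ->] //.
Qed.

Lemma Ck_le V W k (U : set V) (f : V -> W) : Ck k.+1 U f -> Ck k U f.
Proof.
elim: k f => [|k IH] f [fd dfC] /=.
  by move=> x /fd; exact: differentiable_continuous.
by split=> // v; apply: IH.
Qed.

Lemma Ck_cst V W k (U : set V) (c : W) : Ck k U (cst c).
Proof.
elim: k c => [|k IH] c /=; first by move=> x _; exact: cst_continuous.
split=> [x _|v]; first exact: differentiable_cst.
have -> : (fun x => 'd (cst c) x v) = cst (0 : W) by apply/funext => x; rewrite diff_cst.
exact: IH.
Qed.

Lemma CkD V W k (U : set V) (f g : V -> W) : open U ->
  Ck k U f -> Ck k U g -> Ck k U (fun x => f x + g x).
Proof.
move=> oU; elim: k f g => [|k IH] f g /= => [fc gc x Ux|[fd dfC] [gd dgC]].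
  by apply: (@continuousD _ _ _ f g); [exact: fc|exact: gc].
have fgd x : U x -> is_diff x (fun x => f x + g x) (fun v => 'd f x v + 'd g x v).
  move=> Ux; have := differentiableP (fd x Ux); have := differentiableP (gd x Ux).
  by move=> ? ?; exact: is_diffD.
split=> [x /fgd[] //|v]; apply: Ck_ext (IH _ _ (dfC v) (dgC v)) => // x /fgd[_ ->] //.
Qed.

Lemma CkZ V W k (U : set V) (f : V -> R) (X : V -> W) : open U ->
  Ck k U f -> Ck k U X -> Ck k U (fun x => f x *: X x).
Proof.
move=> oU; elim: k f X => [|k IH] f X => [fc Xc x Ux|fC XC].
  exact: cvgZ (fc x Ux) (Xc x Ux).
have [fd dfC] := fC; have [Xd dXC] := XC.
have fXd x (Ux : U x) := is_diff_scale (differentiableP (fd x Ux)) (differentiableP (Xd x Ux)).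
split=> [x /fXd[] //|v].
apply: (@Ck_ext _ _ _ _ (fun x => 'd f x v *: X x + f x *: 'd X x v)) => //.
  by move=> x /fXd[_ ->].
by apply: CkD => //; apply: IH; [exact: dfC|exact: Ck_le|exact: Ck_le|exact: dXC].
Qed.

(** A map with constant differential is affine; for such an [i] the partial
    derivatives of [f \o i] are again partial derivatives of [f], composed with
    [i], which makes the induction on [k] immediate. *)
Lemma Ck_precomp V V' W k (U : set V) (f : V -> W) (i di : V' -> V) :
  open U -> (forall x, is_diff x i di) -> Ck k U f ->
  Ck k (i @^-1` U) (f \o i).
Proof.
move=> oU id.
have ic : continuous i by move=> x; apply: differentiable_continuous; case: (id x).
elim: k f => [|k IH] f /= => [fc x Ux|[fd dfC]].
  exact: continuous_comp (ic x) (fc _ Ux).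
have fid x (Ux : U (i x)) := is_diff_comp (id x) (differentiableP (fd _ Ux)).
split=> [x /fid[] //|v].
apply: Ck_ext (IH _ (dfC (di v))) => [|x /fid[_ -> //]].
by apply: open_comp => // x _; exact: ic.
Qed.

Lemma smooth_at_near V W x (f : V -> W) :
  smooth_at x f -> \forall y \near x, smooth_at y f.
Proof.
move=> [U [oU Ux] fU]; have := open_nbhs_nbhs (conj oU Ux).
by apply: filterS => y Uy; exists U.
Qed.

Lemma smooth_at_diff V W x (f : V -> W) : smooth_at x f -> differentiable f x.
Proof. by move=> [U [oU Ux] /(_ 1%N)[fd _]]; exact: fd. Qed.

Lemma near_smooth_at_diff V W x (f : V -> W) :
  smooth_at x f -> \forall y \near x, differentiable f y.
Proof. by move=> /smooth_at_near; apply: filterS => y; exact: smooth_at_diff. Qed.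

Lemma smooth_at_partial V W x (f : V -> W) v :
  smooth_at x f -> smooth_at x (fun y => 'd f y v).
Proof. by move=> [U Ux fU]; exists U => // k; have [_ /(_ v)] := fU k.+1. Qed.

Lemma near_eq_smooth_at V W x (f g : V -> W) :
  (\near x, f x = g x) -> smooth_at x f -> smooth_at x g.
Proof.
move=> /(@nbhs_interior V x); rewrite /= nbhsE => -[U [oU Ux] Ufg] [U' [oU' U'x] fU'].
have fg y : U y -> f y = g y by move=> /Ufg /interior_subset.
exists (U `&` U'); first by split; [exact: openI|].
move=> k; apply: (@Ck_ext _ _ _ _ f); [exact: openI|by move=> y [/fg]|].
by apply: Ck_subset (fU' k) => y [].
Qed.

Lemma eq_smooth_at V W x (f g : V -> W) : f =1 g -> smooth_at x f -> smooth_at x g.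
Proof. by move=> /funext ->. Qed.

Lemma smooth_at_cst V W x (c : W) : smooth_at x (cst c : V -> W).
Proof. by exists setT => [|k]; [split => //; exact: openT|exact: Ck_cst]. Qed.

Lemma smooth_atD V W x (f g : V -> W) :
  smooth_at x f -> smooth_at x g -> smooth_at x (fun y => f y + g y).
Proof.
move=> [U [oU Ux] fU] [U' [oU' U'x] gU'].
exists (U `&` U'); first by split; [exact: openI|].
by move=> k; apply: CkD; [exact: openI|apply: Ck_subset (fU k) => y []|
  apply: Ck_subset (gU' k) => y []].
Qed.

Lemma smooth_atZ V W x (f : V -> R) (X : V -> W) :
  smooth_at x f -> smooth_at x X -> smooth_at x (fun y => f y *: X y).
Proof.
move=> [U [oU Ux] fU] [U' [oU' U'x] XU'].
exists (U `&` U'); first by split; [exact: openI|].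
by move=> k; apply: CkZ; [exact: openI|apply: Ck_subset (fU k) => y []|
  apply: Ck_subset (XU' k) => y []].
Qed.

Lemma smooth_at_precomp V V' W (f : V -> W) (i di : V' -> V) x :
  (forall x, is_diff x i di) -> smooth_at (i x) f -> smooth_at x (f \o i).
Proof.
move=> id [U [oU Ux] fU]; exists (i @^-1` U).
  split=> //; apply: open_comp => // y _.
  by apply: differentiable_continuous; case: (id y).
by move=> k; exact: Ck_precomp.
Qed.

End Smoothness.

(** * Differentiable maps into a Lie group *)

Section LieGroupCalculus.
Context {R : realType} {n : nat} {G : lieGroup R n}.
Local Notation TG := 'rV[R]_n.
Implicit Types (p q g h : G) (x y z : TG) (V : normedModType R).

Lemma coordK p q : chart_dom (chart_at p) q -> coord_inv p (coord p q) = q.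
Proof. exact: chart_mapK. Qed.

Lemma coord_invK p (u : TG) : (coord p @` chart_dom (chart_at p)) u ->
  coord p (coord_inv p u) = u /\ chart_dom (chart_at p) (coord_inv p u).
Proof. by move=> [q pq <-]; rewrite coordK. Qed.

Lemma coord_inv_self p : coord_inv p (coord p p) = p.
Proof. exact/coordK/chart_at_dom. Qed.

Lemma near_chart_dom p q :
  chart_dom (chart_at p) q -> \forall g \near q, chart_dom (chart_at p) g.
Proof. by move=> pq; apply: open_nbhs_nbhs; split; first exact: chart_dom_open. Qed.

Lemma near_chart_img p q : chart_dom (chart_at p) q ->
  \forall u \near coord p q, (coord p @` chart_dom (chart_at p)) u.
Proof.
move=> pq; apply: open_nbhs_nbhs; split; first exact: chart_img_open.
by exists q.
Qed.

Lemma transition_differentiable p q g :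
  chart_dom (chart_at p) g -> chart_dom (chart_at q) g ->
  differentiable (coord p \o coord_inv q) (coord q g).
Proof.
move=> pg qg; have [/= + _] := chart_at_compat p q 1%N; apply.
by exists g.
Qed.

(** [phi] takes the value [p] at [v], with differential [L] there; [L] has
    values in the tangent space at [p], read in the chart at [p]. *)
Record is_gdiff V (phi : V -> G) (v : V) (p : G) (L : V -> TG) : Prop := {
  gdiff_val : phi v = p;
  gdiff_continuous : {for v, continuous phi};
  gdiff_is_diff : is_diff v (coord p \o phi) L
}.

Lemma gdiff_unique V (phi : V -> G) v p L L' :
  is_gdiff phi v p L -> is_gdiff phi v p L' -> L = L'.
Proof. by move=> [_ _ [_ <-]] [_ _ [_ <-]]. Qed.

Lemma near_preim V (phi : V -> G) v p L (P : set G) :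
  is_gdiff phi v p L -> nbhs p P -> \forall w \near v, P (phi w).
Proof. by move=> [<- phic _] /phic. Qed.

(** Passing from the chart at the value to any other chart around it composes the
    differential with the Jacobian of the transition map. *)
Lemma gdiff_chart V (phi : V -> G) v p L q : is_gdiff phi v p L ->
  chart_dom (chart_at q) p ->
  is_diff v (coord q \o phi) ('d (coord q \o coord_inv p) (coord p p) \o L).
Proof.
move=> phid qp; have [phiv phic phiL] := phid.
have tr := differentiableP (transition_differentiable qp (chart_at_dom p)).
have eqv : (coord p \o phi) v = coord p p by rewrite /= phiv.
apply: near_eq_is_diff (is_diff_chain eqv phiL tr).
have := near_preim phid (near_chart_dom (chart_at_dom p)).
by apply: filterS => w pw /=; rewrite coordK.
Qed.

Lemma gdiff_of_chart V (phi : V -> G) v q : {for v, continuous phi} ->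
  chart_dom (chart_at q) (phi v) -> differentiable (coord q \o phi) v ->
  exists L, is_gdiff phi v (phi v) L.
Proof.
move=> phic qv phid.
have tr := transition_differentiable (chart_at_dom (phi v)) qv.
have phiL := is_diff_chain erefl (differentiableP phid) (differentiableP tr).
eexists; split=> //; apply: near_eq_is_diff phiL.
have : \forall w \near v, chart_dom (chart_at q) (phi w).
  exact: phic (near_chart_dom qv).
by apply: filterS => w pw /=; rewrite coordK.
Qed.

Lemma gdiff_cst V (v : V) p : is_gdiff (cst p) v p 0.
Proof.
split=> //; first exact: cst_continuous.
have -> : coord p \o cst p = cst (coord p p) by [].
exact: is_diff_cst.
Qed.

Lemma coord_inv_continuous p q : chart_dom (chart_at p) q ->
  {for coord p q, continuous (coord_inv p)}.
Proof. by move=> pq; apply: chart_inv_continuous; exists q. Qed.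

Lemma gdiff_coord_inv p : is_gdiff (coord_inv p) (coord p p) p id.
Proof.
split; [exact: coord_inv_self|exact/coord_inv_continuous/chart_at_dom|].
apply: (near_eq_is_diff _ (is_diff_id (coord p p))).
have := near_chart_img (chart_at_dom p).
by apply: filterS => u /coord_invK[].
Qed.

Lemma gdiff_coord_inv_near p :
  \forall u \near coord p p, exists L, is_gdiff (coord_inv p) u (coord_inv p u) L.
Proof.
have := near_chart_img (chart_at_dom p); apply: filterS => _ [q pq <-].
apply: (@gdiff_of_chart _ _ _ p).
- exact: coord_inv_continuous.
- by rewrite coordK.
- have [fd _] : is_diff (coord p q) (coord p \o coord_inv p) (id : TG -> TG).
    apply: (near_eq_is_diff _ (is_diff_id (coord p q))).
    by have := near_chart_img pq; apply: filterS => u /coord_invK[].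
  exact: fd.
Qed.

Definition chart_mul g h (w : TG * TG) : TG :=
  coord (g * h)%g (coord_inv g w.1 * coord_inv h w.2)%g.

Lemma chart_mul_diff g h :
  differentiable (chart_mul g h) (coord g g, coord h h).
Proof. exact/smooth_at_diff/lie_mul_smooth. Qed.

(** Tangent maps of translations are the two partial derivatives of the
    multiplication read in charts. *)
Lemma tangent_rtransE g h x :
  tangent_map (rtrans h) g x = 'd (chart_mul g h) (coord g g, coord h h) (x, 0).
Proof.
have md := differentiableP (chart_mul_diff g h).
have id1 : is_diff (coord g g) (fun u : TG => (u, coord h h)) (fun u => (u, 0)).
  exact: is_diff_pair.
have -> : tangent_map (rtrans h) g = 'd (chart_mul g h \o (fun u => (u, coord h h))) (coord g g).
  rewrite /tangent_map; congr diff; apply/funext => u /=.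
  by rewrite /chart_mul /rtrans /= coord_inv_self.
by have [_ ->] := is_diff_chain erefl id1 md.
Qed.

Lemma tangent_ltransE g h x :
  tangent_map (ltrans g) h x = 'd (chart_mul g h) (coord g g, coord h h) (0, x).
Proof.
have md := differentiableP (chart_mul_diff g h).
have id1 : is_diff (coord h h) (fun u : TG => (coord g g, u)) (fun u => (0, u)).
  exact: is_diff_pair.
have -> : tangent_map (ltrans g) h = 'd (chart_mul g h \o (fun u => (coord g g, u))) (coord h h).
  rewrite /tangent_map; congr diff; apply/funext => u /=.
  by rewrite /chart_mul /ltrans /= coord_inv_self.
by have [_ ->] := is_diff_chain erefl id1 md.
Qed.

(** The Leibniz rule of the group. It is the source of all the identities between
    tangent maps of translations below, by uniqueness of the differential. *)
Lemma gdiff_mul V (phi psi : V -> G) v p q L M :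
  is_gdiff phi v p L -> is_gdiff psi v q M ->
  is_gdiff (fun w => phi w * psi w)%g v (p * q)%g
    (fun w => tangent_map (rtrans q) p (L w) + tangent_map (ltrans p) q (M w)).
Proof.
move=> phid psid; have [phiv phic phiL] := phid; have [psiv psic psiM] := psid.
split; first by rewrite phiv psiv.
  apply: (@continuous_comp _ _ _ (fun w => (phi w, psi w)) (fun z : G * G => z.1 * z.2)%g).
    exact: cvg_pair.
  exact: lie_mul_continuous.
have md := differentiableP (chart_mul_diff p q).
have eqv : (coord p (phi v), coord q (psi v)) = (coord p p, coord q q).
  by rewrite phiv psiv.
have := is_diff_chain eqv (is_diff_pair phiL psiM) md.
move=> /is_diff_eq cd; apply: near_eq_is_diff (cd _ _) => [|].
  have := near_preim phid (near_chart_dom (chart_at_dom p)).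
  have := near_preim psid (near_chart_dom (chart_at_dom q)).
  by apply: filterS2 => w qw pw; rewrite /chart_mul /= !coordK.
apply/funext => w /=; rewrite tangent_rtransE tangent_ltransE -linearD.
by congr ('d _ _ _); congr (_, _); rewrite /= ?addr0 ?add0r.
Qed.

Lemma gdiff_inv V (phi : V -> G) v p L : is_gdiff phi v p L ->
  exists M, is_gdiff (fun w => (phi w)^-1)%g v p^-1%g M.
Proof.
move=> phid; have [phiv phic phiL] := phid.
have invd := differentiableP (smooth_at_diff (lie_inv_smooth p)).
have eqv : (coord p \o phi) v = coord p p by rewrite /= phiv.
have cd := is_diff_chain eqv phiL invd.
eexists; split; first by rewrite phiv.
  apply: (@continuous_comp _ _ _ phi (fun g : G => g^-1)%g) => //.
  exact: lie_inv_continuous.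
apply: near_eq_is_diff cd.
have := near_preim phid (near_chart_dom (chart_at_dom p)).
by apply: filterS => w pw /=; rewrite [chart_inv _ _]coordK.
Qed.

Lemma tangent_map0 (F : G -> G) p : tangent_map F p 0 = 0.
Proof. by rewrite /tangent_map linear0. Qed.

Lemma gdiff_ltrans V (phi : V -> G) v p L g : is_gdiff phi v p L ->
  is_gdiff (fun w => g * phi w)%g v (g * p)%g (tangent_map (ltrans g) p \o L).
Proof.
move=> phid; have [phiv phic phiL] := gdiff_mul (gdiff_cst v g) phid.
split=> //; apply: is_diff_eq phiL _; apply/funext => w /=.
by rewrite tangent_map0 add0r.
Qed.

Lemma gdiff_rtrans V (phi : V -> G) v p L g : is_gdiff phi v p L ->
  is_gdiff (fun w => phi w * g)%g v (p * g)%g (tangent_map (rtrans g) p \o L).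
Proof.
move=> phid; have [phiv phic phiL] := gdiff_mul phid (gdiff_cst v g).
split=> //; apply: is_diff_eq phiL _; apply/funext => w /=.
by rewrite tangent_map0 addr0.
Qed.

Lemma tangent_ltransM g h p x :
  tangent_map (ltrans g) (h * p)%g (tangent_map (ltrans h) p x) =
  tangent_map (ltrans (g * h)%g) p x.
Proof.
have d1 := gdiff_ltrans g (gdiff_ltrans h (gdiff_coord_inv p)).
have := gdiff_ltrans (g * h)%g (gdiff_coord_inv p).
rewrite -mulgA; under eq_fun do rewrite -mulgA.
by move=> /(gdiff_unique d1) /(congr1 (fun F => F x)).
Qed.

Lemma tangent_rtransM g h p x :
  tangent_map (rtrans g) (p * h)%g (tangent_map (rtrans h) p x) =
  tangent_map (rtrans (h * g)%g) p x.
Proof.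
have d1 := gdiff_rtrans g (gdiff_rtrans h (gdiff_coord_inv p)).
have := gdiff_rtrans (h * g)%g (gdiff_coord_inv p).
rewrite mulgA; under eq_fun do rewrite mulgA.
by move=> /(gdiff_unique d1) /(congr1 (fun F => F x)).
Qed.

Lemma tangent_ltrans1 p x : tangent_map (ltrans 1%g) p x = x.
Proof.
have := gdiff_ltrans 1%g (gdiff_coord_inv p).
rewrite mul1g; under eq_fun do rewrite mul1g.
by move=> /(gdiff_unique (gdiff_coord_inv p)) /(congr1 (fun F => F x)).
Qed.

Lemma tangent_rtrans1 p x : tangent_map (rtrans 1%g) p x = x.
Proof.
have := gdiff_rtrans 1%g (gdiff_coord_inv p).
rewrite mulg1; under eq_fun do rewrite mulg1.
by move=> /(gdiff_unique (gdiff_coord_inv p)) /(congr1 (fun F => F x)).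
Qed.

End LieGroupCalculus.

(** * Left and right invariant vector fields *)

Section ProductDerivatives.
Context {R : realType}.
Implicit Types (V W E : normedModType R).

Lemma is_diff_fst V W (y : V * W) : is_diff y (fst : V * W -> V) fst.
Proof.
have fc : continuous (fst : V * W -> V) by move=> ?; exact: cvg_fst.
pose l : {linear (V * W)%type -> V} := fst.
split; first exact: (linear_differentiable (f := l)).
exact: (diff_lin (f := l)).
Qed.

Lemma is_diff_snd V W (y : V * W) : is_diff y (snd : V * W -> W) snd.
Proof.
have fc : continuous (snd : V * W -> W) by move=> ?; exact: cvg_snd.
pose l : {linear (V * W)%type -> W} := snd.
split; first exact: (linear_differentiable (f := l)).
exact: (diff_lin (f := l)).
Qed.

Lemma is_diff_slot1 V W (v : V) (w : W) :
  is_diff v (fun u : V => (u, w)) (fun u => (u, 0)).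
Proof. exact: is_diff_pair. Qed.

Lemma is_diff_slot2 V W (v : V) (w : W) :
  is_diff w (fun u : W => (v, u)) (fun u => (0, u)).
Proof. exact: is_diff_pair. Qed.

Lemma near_slot1 V W (v : V) (w : W) (P : set (V * W)) :
  nbhs (v, w) P -> \forall u \near v, P (u, w).
Proof.
have [/differentiable_continuous uc _] := is_diff_slot1 v w.
by move=> /uc.
Qed.

Lemma near_slot2 V W (v : V) (w : W) (P : set (V * W)) :
  nbhs (v, w) P -> \forall u \near w, P (v, u).
Proof.
have [/differentiable_continuous uc _] := is_diff_slot2 v w.
by move=> /uc.
Qed.

Lemma near_fst V W (y : V * W) (P : set V) :
  nbhs y.1 P -> \forall u \near y, P u.1.
Proof. by case: y => v w; exact: (@cvg_fst _ _ (nbhs v) (nbhs w) _ P). Qed.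

Lemma near_snd V W (y : V * W) (P : set W) :
  nbhs y.2 P -> \forall u \near y, P u.2.
Proof. by case: y => v w; exact: (@cvg_snd _ _ (nbhs v) (nbhs w) _ P). Qed.

(** Symmetry of the second derivative of the map [l (v, P w) = r (Q v, w)], whose
    derivative along [V] is visible on the left-hand side and whose derivative
    along [W] is visible on the right-hand side. For [l] and [r] a multiplication
    and [P], [Q] translations, the equation is associativity. *)
Lemma mixed_partials_eq V W E n (l : V * E -> 'rV[R]_n) (r : E * W -> 'rV[R]_n)
    (P : W -> E) (Q : V -> E) (y0 : V * W) a x z :
  smooth_at (y0.1, a) l -> smooth_at (a, y0.2) r ->
  P y0.2 = a -> Q y0.1 = a ->
  (\forall w \near y0.2, differentiable P w) ->
  (\forall v \near y0.1, differentiable Q v) ->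
  (\forall y \near y0, l (y.1, P y.2) = r (Q y.1, y.2)) ->
  'd (fun e => 'd l (y0.1, e) (x, 0)) a ('d P (y0.2) z) =
  'd (fun e => 'd r (e, y0.2) (0, z)) a ('d Q (y0.1) x).
Proof.
move=> ls rs Pa Qa Pnear Qnear lr.
pose f (y : V * W) := l (y.1, P y.2).
pose f' (y : V * W) := r (Q y.1, y.2).
have argP (y : V * W) (dP : W -> E) : is_diff (y.2) P dP ->
    is_diff y (fun y : V * W => (y.1, P y.2)) (fun u => (u.1, dP u.2)).
  by move=> dPy; exact: is_diff_pair (is_diff_fst y) (is_diff_comp (is_diff_snd y) dPy).
have argQ (y : V * W) (dQ : V -> E) : is_diff (y.1) Q dQ ->
    is_diff y (fun y : V * W => (Q y.1, y.2)) (fun u => (dQ u.1, u.2)).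
  by move=> dQy; exact: is_diff_pair (is_diff_comp (is_diff_fst y) dQy) (is_diff_snd y).
have Pd := argP y0 _ (differentiableP (nbhs_singleton Pnear)).
have Qd := argQ y0 _ (differentiableP (nbhs_singleton Qnear)).
have Pcont : {for y0, continuous (fun y : V * W => (y.1, P y.2))}.
  by have [/differentiable_continuous] := Pd.
have Qcont : {for y0, continuous (fun y : V * W => (Q y.1, y.2))}.
  by have [/differentiable_continuous] := Qd.
have fd : \forall y \near y0,
    differentiable f y /\ 'd f y (x, 0) = 'd l (y.1, P y.2) (x, 0).
  have ld : \forall y \near y0, differentiable l (y.1, P y.2).
    by have := near_smooth_at_diff ls; rewrite -Pa => /Pcont.
  apply: filterS2 ld (near_snd Pnear) => y ly /differentiableP Py.
  have [fdy fE] := is_diff_chain erefl (argP y _ Py) (differentiableP ly).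
  by split=> //; rewrite fE /= linear0.
have f'd : \forall y \near y0,
    differentiable f' y /\ 'd f' y (0, z) = 'd r (Q y.1, y.2) (0, z).
  have rd : \forall y \near y0, differentiable r (Q y.1, y.2).
    by have := near_smooth_at_diff rs; rewrite -Qa => /Qcont.
  apply: filterS2 rd (near_fst Qnear) => y ry /differentiableP Qy.
  have [fdy fE] := is_diff_chain erefl (argQ y _ Qy) (differentiableP ry).
  by split=> //; rewrite fE /= linear0.
have f_z : \forall y \near y0, 'd f y (0, z) = 'd r (Q y.1, y.2) (0, z).
  have := nbhs_interior lr; apply: filterS2 f'd => y [/differentiableP f'y <-] nff'.
  have nf'f : \near y, f' y = f y by apply: filterS nff' => u /esym.
  have [_ fE] := near_eq_is_diff nf'f f'y.
  exact: (congr1 (@^~ (0, z)) fE).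
have lpart := smooth_at_partial (x, 0) ls.
have rpart := smooth_at_partial (0, z) rs.
have eqP : (y0.1, P y0.2) = (y0.1, a) by rewrite Pa.
have eqQ : (Q y0.1, y0.2) = (a, y0.2) by rewrite Qa.
have gd := is_diff_chain eqP Pd (differentiableP (smooth_at_diff lpart)).
have hd := is_diff_chain eqQ Qd (differentiableP (smooth_at_diff rpart)).
have [gd1 gE] := gd; have [hd1 hE] := hd.
have f1 : \forall y \near y0, differentiable f y by apply: filterS fd => y [].
have f2 : \forall y \near y0, 'd f y (x, 0) = 'd l (y.1, P y.2) (x, 0).
  by apply: filterS fd => y [].
have [_ lslotE] := is_diff_chain erefl (is_diff_slot2 (y0.1) a)
  (differentiableP (smooth_at_diff lpart)).
have [_ rslotE] := is_diff_chain erefl (is_diff_slot1 a (y0.2))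
  (differentiableP (smooth_at_diff rpart)).
have e1 := congr1 (@^~ ('d P (y0.2) z)) lslotE.
have e2 := congr1 (@^~ (0, z)) gE.
have e3 := mixed_derivatives_eq f1 f2 f_z gd1 hd1.
have e4 := congr1 (@^~ (x, 0)) hE.
have e5 := congr1 (@^~ ('d Q (y0.1) x)) rslotE.
exact: etrans e1 (etrans (esym e2) (etrans e3 (etrans e4 (esym e5)))).
Qed.

End ProductDerivatives.

Section InvariantFields.
Context {R : realType} {n : nat} {G : lieGroup R n}.
Local Notation TG := 'rV[R]_n.
Implicit Types (p q g h : G) (x y z : TG) (V W : normedModType R).

Definition right_invariant_vf (x : TG) : G -> TG :=
  fun g => tangent_map (rtrans g) 1%g x.

Local Notation "x ^l" := (left_invariant_vf G x) (at level 2, format "x ^l").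
Local Notation "x ^r" := (right_invariant_vf x) (at level 2, format "x ^r").

Lemma left_vf1 x : x^l 1%g = x.
Proof. exact: tangent_ltrans1. Qed.

Lemma right_vf1 x : x^r 1%g = x.
Proof. exact: tangent_rtrans1. Qed.

Lemma left_vf_translate g h x : tangent_map (ltrans g) h (x^l h) = x^l (g * h)%g.
Proof. by have := tangent_ltransM g h 1%g x; rewrite mulg1. Qed.

Lemma right_vf_translate g h x : tangent_map (rtrans g) h (x^r h) = x^r (h * g)%g.
Proof. by have := tangent_rtransM g h 1%g x; rewrite mul1g. Qed.

Lemma pushforward_left_vf h x :
  pushforward (ltrans h) (ltrans h^-1%g) x^l = x^l.
Proof.
by apply/funext => q; rewrite /pushforward left_vf_translate /ltrans mulgA mulgV mul1g.
Qed.

Lemma pushforward_right_vf h x :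
  pushforward (rtrans h) (rtrans h^-1%g) x^r = x^r.
Proof.
by apply/funext => q; rewrite /pushforward right_vf_translate /rtrans -mulgA mulVg mulg1.
Qed.

(** Left invariant fields form a frame. *)
Lemma left_vf_onto p (v : TG) : exists x, v = x^l p.
Proof.
exists (tangent_map (ltrans p^-1%g) p v).
have := tangent_ltransM p p^-1%g p v.
by rewrite mulVg mulgV tangent_ltrans1.
Qed.

Definition rmul_chart p (w : TG * TG) : TG :=
  coord p (coord_inv p w.1 * coord_inv 1%g w.2)%g.

Definition lmul_chart p (w : TG * TG) : TG :=
  coord p (coord_inv 1%g w.1 * coord_inv p w.2)%g.

Local Notation c := (coord (1%g : G) 1%g).

Lemma rmul_chart_smooth p : smooth_at (coord p p, c) (rmul_chart p).
Proof. by have := lie_mul_smooth p 1%g; rewrite mulg1. Qed.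

Lemma lmul_chart_smooth p : smooth_at (c, coord p p) (lmul_chart p).
Proof. by have := lie_mul_smooth 1%g p; rewrite mul1g. Qed.

(** In the chart at [p], a left invariant field is a partial derivative of the
    multiplication; this is how it inherits the smoothness of the latter. *)
Lemma local_rep_left_vf p x : \forall u \near coord p p,
  local_rep p x^l u = 'd (rmul_chart p) (u, c) (0, x).
Proof.
have dnear := near_slot1 (near_smooth_at_diff (rmul_chart_smooth p)).
have := near_chart_img (chart_at_dom p).
apply: filterS2 dnear => u md /coord_invK[_]; set q := coord_inv p u => pq.
have := gdiff_ltrans q (gdiff_coord_inv (1%g : G)); rewrite mulg1.
move=> /gdiff_chart -/(_ _ pq)[_ qE].
have [_ uE] := is_diff_chain erefl (is_diff_slot2 u c) (differentiableP md).
exact: etrans (esym (congr1 (@^~ x) qE)) (congr1 (@^~ x) uE).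
Qed.

Lemma local_rep_right_vf p x : \forall u \near coord p p,
  local_rep p x^r u = 'd (lmul_chart p) (c, u) (x, 0).
Proof.
have dnear := near_slot2 (near_smooth_at_diff (lmul_chart_smooth p)).
have := near_chart_img (chart_at_dom p).
apply: filterS2 dnear => u md /coord_invK[_]; set q := coord_inv p u => pq.
have := gdiff_rtrans q (gdiff_coord_inv (1%g : G)); rewrite mul1g.
move=> /gdiff_chart -/(_ _ pq)[_ qE].
have [_ uE] := is_diff_chain erefl (is_diff_slot1 c u) (differentiableP md).
exact: etrans (esym (congr1 (@^~ x) qE)) (congr1 (@^~ x) uE).
Qed.

Lemma left_vf_smooth x : smooth_vf x^l.
Proof.
move=> p; apply: near_eq_smooth_at (smooth_at_precomp (i := fun u : TG => (u, c))
  (fun u => is_diff_slot1 u c) (smooth_at_partial (0, x) (rmul_chart_smooth p))).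
by apply: filterS (local_rep_left_vf p x).
Qed.

Lemma right_vf_smooth x : smooth_vf x^r.
Proof.
move=> p; apply: near_eq_smooth_at (smooth_at_precomp (i := fun u : TG => (c, u))
  (is_diff_slot2 c) (smooth_at_partial (x, 0) (lmul_chart_smooth p))).
by apply: filterS (local_rep_right_vf p x).
Qed.

(** Left and right translations commute; infinitesimally, this is the symmetry
    of the second derivative of [(w, v) |-> w * p * v]. *)
Lemma lie_bracket_left_right z x p : lie_bracket z^l x^r p = 0.
Proof.
set a := coord p p.
pose P v : TG := coord p (p * coord_inv 1%g v)%g.
pose Q w : TG := coord p (coord_inv 1%g w * p)%g.
have Pd : is_diff c P (tangent_map (ltrans p) 1%g).
  by have := gdiff_ltrans p (gdiff_coord_inv (1%g : G)); rewrite mulg1 => -[].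
have Qd : is_diff c Q (tangent_map (rtrans p) 1%g).
  by have := gdiff_rtrans p (gdiff_coord_inv (1%g : G)); rewrite mul1g => -[].
have Pc : P c = a by rewrite /P coord_inv_self mulg1.
have Qc : Q c = a by rewrite /Q coord_inv_self mul1g.
have Pnear : \forall v \near c, differentiable P v.
  have dnear := near_slot2 (near_smooth_at_diff (rmul_chart_smooth p)).
  apply: filterS dnear => v md.
  have [+ _] := is_diff_chain erefl (is_diff_slot2 a v) (differentiableP md).
  by congr (differentiable _ _); apply/funext => u /=; rewrite /rmul_chart /= coord_inv_self.
have Qnear : \forall w \near c, differentiable Q w.
  have dnear := near_slot1 (near_smooth_at_diff (lmul_chart_smooth p)).
  apply: filterS dnear => w md.
  have [+ _] := is_diff_chain erefl (is_diff_slot1 w a) (differentiableP md).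
  by congr (differentiable _ _); apply/funext => u /=; rewrite /lmul_chart /= coord_inv_self.
pose cc : TG * TG := (c, c).
have ass : \forall y \near cc, lmul_chart p (y.1, P y.2) = rmul_chart p (Q y.1, y.2).
  have pP : \forall v \near c, chart_dom (chart_at p) (p * coord_inv 1%g v)%g.
    have := near_preim (gdiff_ltrans p (gdiff_coord_inv (1%g : G))); apply.
    by rewrite mulg1; exact/near_chart_dom/chart_at_dom.
  have pQ : \forall w \near c, chart_dom (chart_at p) (coord_inv 1%g w * p)%g.
    have := near_preim (gdiff_rtrans p (gdiff_coord_inv (1%g : G))); apply.
    by rewrite mul1g; exact/near_chart_dom/chart_at_dom.
  apply: filterS2 (near_fst (y := cc) pQ) (near_snd (y := cc) pP) => y Qy Py.
  by rewrite /lmul_chart /rmul_chart /= !coordK // mulgA.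
have mixed := @mixed_partials_eq _ _ _ _ _ _ _ _ _ cc _ x z
  (lmul_chart_smooth p) (rmul_chart_smooth p) Pc Qc Pnear Qnear ass.
have lpart := differentiableP (smooth_at_diff (smooth_at_partial (x, 0) (lmul_chart_smooth p))).
have rpart := differentiableP (smooth_at_diff (smooth_at_partial (0, z) (rmul_chart_smooth p))).
have lslot := is_diff_chain erefl (is_diff_slot2 c a) lpart.
have rslot := is_diff_chain erefl (is_diff_slot1 a c) rpart.
have lloc : \forall u \near a, 'd (lmul_chart p) (c, u) (x, 0) = local_rep p x^r u.
  by apply: filterS (local_rep_right_vf p x) => u; exact: esym.
have rloc : \forall u \near a, 'd (rmul_chart p) (u, c) (0, z) = local_rep p z^l u.
  by apply: filterS (local_rep_left_vf p z) => u; exact: esym.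
have [_ lE] := near_eq_is_diff lloc lslot.
have [_ rE] := near_eq_is_diff rloc rslot.
have [_ PE] := Pd; have [_ QE] := Qd.
have [_ lsE] := lslot; have [_ rsE] := rslot.
have lE' := etrans lE (esym lsE).
have rE' := etrans rE (esym rsE).
have zE : z^l p = 'd P c z := esym (congr1 (@^~ z) PE).
have xE : x^r p = 'd Q c x := esym (congr1 (@^~ x) QE).
have e1 := congr1 ('d (local_rep p x^r) a) zE.
have e2 := congr1 ('d (local_rep p z^l) a) xE.
have e3 := etrans e1 (congr1 (@^~ ('d P c z)) lE').
have e4 := etrans e2 (congr1 (@^~ ('d Q c x)) rE').
apply/eqP; rewrite subr_eq0; apply/eqP.
exact: etrans e3 (etrans mixed (esym e4)).
Qed.

End InvariantFields.

(** * Functions with zero derivative; smooth fields *)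

Section Constancy.
Context {R : realType} {n : nat} {G : lieGroup R n}.
Local Notation TG := 'rV[R]_n.
Implicit Types (p q g h : G) (x y z : TG).

Lemma locally_constant_cst T (f : G -> T) : connected [set: G] ->
  (forall p, \forall q \near p, f q = f p) -> forall p q, f q = f p.
Proof.
move=> Gconn floc p q.
(* the level set of [p] is open and closed *)
pose B := [set g : G | f g = f p].
have Bopen : open B.
  by rewrite openE => g fg; apply: filterS (floc g) => h fh; rewrite /B /= fh.
have Bclosed : closed B.
  rewrite -[B]setCK; apply: open_closedC; rewrite openE => g /= fg.
  by apply: filterS (floc g) => h; rewrite /B /setC /= => ->.
have BT : B = [set: G].
  by apply: Gconn; [exists p|exists B; rewrite ?setTI|exists B; rewrite ?setTI].
by have : [set: G] q by []; rewrite -BT.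
Qed.

(** At each point the left invariant fields span the tangent space, so the
    differential of [f] vanishes in every chart. *)
Lemma vf_zero_cst (f : G -> R) : connected [set: G] -> smooth_fun f ->
  (forall x p, vf_apply (left_invariant_vf G x) f p = 0) ->
  forall p q, f q = f p.
Proof.
move=> Gconn fs fx; apply: locally_constant_cst => // p.
have f0 q : is_diff (coord q q) (f \o coord_inv q) (0 : TG -> R).
  split; first exact/smooth_at_diff/fs.
  apply/funext => v; have [x ->] := left_vf_onto q v.
  exact: fx.
have cst_near : \forall u \near coord p p,
    (f \o coord_inv p) u = (f \o coord_inv p) (coord p p).
  apply: zero_diff_near_cst.
  apply: filterS (gdiff_coord_inv_near p) => u [L Ld].
  have [_ _ LD] := Ld; set q := coord_inv p u in Ld LD.
  apply: near_eq_is_diff (is_diff_chain erefl LD (f0 q)).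
  have := near_preim Ld (near_chart_dom (chart_at_dom q)).
  by apply: filterS => w qw; rewrite /= coordK.
have pc : {for p, continuous (coord p)} by exact/chart_map_continuous/chart_at_dom.
have near_p : \forall q \near p, f (coord_inv p (coord p q)) = f (coord_inv p (coord p p)).
  exact: pc cst_near.
apply: filterS2 near_p (near_chart_dom (chart_at_dom p)) => q + pq.
by rewrite coordK // coord_inv_self.
Qed.

Lemma gdiff_zero_cst (F : G -> G) : connected [set: G] ->
  (forall p, \forall u \near coord p p,
     is_gdiff (F \o coord_inv p) u (F (coord_inv p u)) 0) ->
  forall p q, F q = F p.
Proof.
move=> Gconn F0; apply: locally_constant_cst => // p.
have Fp := nbhs_singleton (F0 p); rewrite coord_inv_self in Fp.
have Fdom := near_preim Fp (near_chart_dom (chart_at_dom (F p))).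
have cst_near : \forall u \near coord p p, (coord (F p) \o (F \o coord_inv p)) u =
    (coord (F p) \o (F \o coord_inv p)) (coord p p).
  apply: zero_diff_near_cst_row.
  apply: filterS2 (F0 p) Fdom => u Fu domu.
  by apply: is_diff_eq (gdiff_chart Fu domu) _; apply/funext => v /=; rewrite linear0.
have pc : {for p, continuous (coord p)} by exact/chart_map_continuous/chart_at_dom.
have near_p : \forall q \near p,
    coord (F p) (F (coord_inv p (coord p q))) = coord (F p) (F (coord_inv p (coord p p))) /\
    chart_dom (chart_at (F p)) (F (coord_inv p (coord p q))).
  exact: pc (filterI cst_near Fdom).
apply: filterS2 near_p (near_chart_dom (chart_at_dom p)) => q + pq.
rewrite coordK // coord_inv_self => -[e Fq].
by rewrite -[F q](coordK Fq) e coordK //; exact: chart_at_dom.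
Qed.

End Constancy.

Section SmoothFields.
Context {R : realType} {n : nat} {G : lieGroup R n}.
Local Notation TG := 'rV[R]_n.
Implicit Types (X Y : G -> TG) (f : G -> R).

Lemma smooth_fun_cst (a : R) : smooth_fun (fun _ : G => a).
Proof. by move=> p; exact: smooth_at_cst. Qed.

Lemma vf_apply_cst X (a : R) p : vf_apply X (fun _ : G => a) p = 0.
Proof. by rewrite /vf_apply (_ : _ \o _ = cst a) // diff_cst. Qed.

Lemma smooth_vf0 : smooth_vf (fun _ : G => 0 : TG).
Proof.
by move=> p; apply: eq_smooth_at (smooth_at_cst (coord p p) 0) => u; rewrite /local_rep linear0.
Qed.

Lemma smooth_vfD X Y : smooth_vf X -> smooth_vf Y -> smooth_vf (fun q => X q + Y q).
Proof.
by move=> Xs Ys p; apply: eq_smooth_at (smooth_atD (Xs p) (Ys p)) => u; rewrite /local_rep linearD.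
Qed.

Lemma smooth_vfZ f X : smooth_fun f -> smooth_vf X -> smooth_vf (fun q => f q *: X q).
Proof.
by move=> fs Xs p; apply: eq_smooth_at (smooth_atZ (fs p) (Xs p)) => u; rewrite /local_rep linearZ.
Qed.

Lemma smooth_vf_sum I (r : seq I) (f : I -> G -> R) (X : I -> G -> TG) :
  (forall i, smooth_fun (f i)) -> (forall i, smooth_vf (X i)) ->
  smooth_vf (fun q => \sum_(i <- r) f i q *: X i q).
Proof.
move=> fs Xs; elim: r => [|i r IH].
  have -> : (fun q => \sum_(i <- [::]) f i q *: X i q) = (fun=> 0).
    by apply/funext => q; rewrite big_nil.
  exact: smooth_vf0.
have -> : (fun q => \sum_(i <- i :: r) f i q *: X i q) =
    (fun q => f i q *: X i q + \sum_(i <- r) f i q *: X i q).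
  by apply/funext => q; rewrite big_cons.
by apply: smooth_vfD => //; exact: smooth_vfZ.
Qed.

End SmoothFields.

(** * Positive special Kähler algebras with associative product *)

Section ScalarFunctions.
Context {R : realType} {V : lmodType R} (f : V -> R).
Hypothesis f_lin : scalar f.
Let fM := GRing.isLinear.Build _ _ _ _ _ f_lin.
Let fL : {linear V -> R | *%R} := HB.pack f fM.

Lemma scalar0 : f 0 = 0.
Proof. exact: (linear0 fL). Qed.

Lemma scalarN u : f (- u) = - f u.
Proof. exact: (linearN fL). Qed.

Lemma scalarB u v : f (u - v) = f u - f v.
Proof. exact: (linearB fL). Qed.

Lemma scalar_sum I (r : seq I) (u : I -> V) :
  f (\sum_(i <- r) u i) = \sum_(i <- r) f (u i).
Proof. exact: (linear_sum fL). Qed.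

Lemma scalar_scale (a : R) u : f (a *: u) = a * f u.
Proof. by have := f_lin a u 0; rewrite /= scalar0 !addr0. Qed.

End ScalarFunctions.

Lemma alternating_antisym (R : realType) (V : lmodType R) (f : V -> V -> R) :
  (forall v, scalar (f ^~ v)) -> (forall u, scalar (f u)) -> (forall u, f u u = 0) ->
  forall u v, f u v = - f v u.
Proof.
move=> linl linr alt u v; have := alt (u - v).
rewrite (scalarB (linl (u - v))) !(scalarB (linr _)) !alt sub0r subr0 -opprD.
by move=> /eqP; rewrite oppr_eq0 addr_eq0 => /eqP.
Qed.

Section ProductVanishes.
Context {R : realType} {V : lmodType R}.
Variables (omega : V -> V -> R) (j : V -> V) (m : V -> V -> V).
Hypothesis omega_linl : forall v, scalar (omega ^~ v).
Hypothesis omega_linr : forall u, scalar (omega u).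
Hypothesis omega_alt : forall u, omega u u = 0.
Hypothesis omega_nondeg : forall u, (forall v, omega u v = 0) -> u = 0.
Hypothesis j0 : j 0 = 0.
Hypothesis metric_sym : forall u v, omega u (j v) = omega v (j u).
Hypothesis metric_pos : forall u, u != 0 -> 0 < omega u (j u).
Hypothesis mA : forall x y z, m (m x y) z = m x (m y z).
Hypothesis m_skew : forall x y z, omega (m x y) z + omega y (m x z) = 0.
Hypothesis m_j : forall x y, m x (j y) - j (m x y) = m y (j x) - j (m y x).

Let omega0l w : omega 0 w = 0. Proof. exact: (scalar0 (omega_linl w)). Qed.

Let omegaNl u w : omega (- u) w = - omega u w.
Proof. exact: (scalarN (omega_linl w)). Qed.

Let omegaC u v : omega u v = - omega v u.
Proof. exact: alternating_antisym. Qed.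

Let mskew x y z : omega (m x y) z = - omega y (m x z).
Proof. by apply/eqP; rewrite -addr_eq0 m_skew. Qed.

Let omega_inj u v : (forall w, omega u w = omega v w) -> u = v.
Proof.
move=> uv; apply/eqP; rewrite -subr_eq0; apply/eqP/omega_nondeg => w.
by rewrite (scalarB (omega_linl w)) uv subrr.
Qed.

Let mN x y : m x (- y) = - m x y.
Proof. by apply: omega_inj => w; rewrite omegaNl !mskew omegaNl. Qed.

(** Left multiplications are skew for [omega], so that the adjoint of
    [m (m x y)] reverses the order of [m x] and [m y], which associativity turns
    into anticommutation. *)
Let m_anticomm x y z : m x (m y z) = - m y (m x z).
Proof.
apply: omega_inj => w; rewrite -mA [LHS]mskew mA.
by rewrite omegaNl (mskew y) opprK [RHS]mskew.
Qed.

(** A cyclic permutation of three anticommuting factors is even; moving a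
    product of two across the third changes the sign. *)
Let m3 x y z w : m x (m y (m z w)) = 0.
Proof.
have e1 : m x (m y (m z w)) = - m z (m x (m y w)).
  by rewrite -mA m_anticomm mA.
have e2 : m x (m y (m z w)) = m z (m x (m y w)).
  by rewrite (m_anticomm y) mN (m_anticomm x) opprK.
move: e1; rewrite -e2 => /eqP; rewrite -subr_eq0 opprK -mulr2n -scaler_nat.
by rewrite scaler_eq0 pnatr_eq0 /= => /eqP.
Qed.

(** The symmetry of the derivative of [j] gives [m x (j p) = 0], and [m x] is skew
    for [omega]. *)
Let annihilator_orthogonal p : (forall x, m p x = 0) -> (forall x, m x p = 0) ->
  forall x y, omega p (j (m x y)) = 0.
Proof.
move=> px xp x y.
have mjp : m x (j p) = 0.
  by have := m_j x p; rewrite !px xp j0 !subr0.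
by rewrite metric_sym mskew mjp omegaC omega0l !oppr0.
Qed.

Let annihilating_product a b : (forall x, m (m a b) x = 0) ->
  (forall x, m x (m a b) = 0) -> m a b = 0.
Proof.
move=> px xp; apply/eqP/negPn/negP => /metric_pos.
by rewrite annihilator_orthogonal // ltxx.
Qed.

(** Left multiplications anticommute, hence products of four factors vanish. A
    product of three factors is then annihilated on both sides, hence orthogonal
    to all products, itself included, hence zero; the same argument applies next
    to products of two factors. *)
Lemma product_vanishes x y : m x y = 0.
Proof.
have m2 a b c : m a (m b c) = 0.
  by apply: annihilating_product => w; rewrite ?mA m3.
by apply: annihilating_product => w; rewrite ?mA m2.
Qed.

End ProductVanishes.

(** * Special Kähler Lie groups *)

Lemma tangent_mapN (R : realType) (n : nat) (G : lieGroup R n) (F : G -> G) p x :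
  tangent_map F p (- x) = - tangent_map F p x.
Proof. by rewrite /tangent_map linearN. Qed.

Section SpecialKahlerGroup.
Context {R : realType} {n : nat} {G : lieGroup R n}.
Local Notation TG := 'rV[R]_n.
Implicit Types (p q g h : G) (x y z : TG) (X Y Z : G -> TG).
Variables (omega : G -> TG -> TG -> R) (J : G -> TG -> TG)
  (nabla : (G -> TG) -> (G -> TG) -> (G -> TG)).
Hypothesis sk : is_special_kahler_lie_group omega J nabla.

Local Notation "x ^l" := (left_invariant_vf G x) (at level 2, format "x ^l").
Local Notation "x ^r" := (@right_invariant_vf _ _ G x) (at level 2, format "x ^r").
Local Notation omega1 := (omega 1%g).
Local Notation "x ** y" := (nabla x^l y^l 1%g) (at level 40).

Let symp := sk_symplectic sk.
Let conn := sk_connection sk.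

Lemma form_left_vf x y p : omega p (x^l p) (y^l p) = omega1 x y.
Proof. by have := sk_form_left_invariant sk p 1%g x y; rewrite mulg1. Qed.

Lemma endo_left_vf x : eval1 J x^l = (J 1%g x)^l.
Proof.
apply/funext => p; rewrite /eval1.
by have := sk_endo_left_invariant sk p 1%g x; rewrite mulg1.
Qed.

(** Inversion of the Gram matrix of the form. *)
Lemma form_dual_basis : exists e : 'I_n -> TG, forall x i, omega1 x (e i) = x 0 i.
Proof.
(* nondegeneracy is the triviality of the kernel of the Gram matrix *)
pose M : 'M[R]_n := \matrix_(i, k) omega1 (delta_mx 0 i) (delta_mx 0 k).
have linl := sympl_linl symp 1%g; have linr := sympl_linr symp 1%g.
have xM x k : (x *m M) 0 k = omega1 x (delta_mx 0 k).
  rewrite mxE {2}(row_sum_delta x) (scalar_sum (linl _)).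
  by apply: eq_bigr => i _; rewrite (scalar_scale (linl _)) mxE.
have omegaE x y : omega1 x y = (x *m M *m y^T) 0 0.
  rewrite mxE {1}(row_sum_delta y) (scalar_sum (linr _)).
  by apply: eq_bigr => k _; rewrite (scalar_scale (linr _)) xM mxE mulrC.
have Munit : M \in unitmx.
  rewrite -row_free_unit -kermx_eq0; apply/rowV0P => v /sub_kermxP vM.
  by apply: (@sympl_nondeg _ _ _ _ symp 1%g) => w; rewrite omegaE vM mul0mx mxE.
exists (fun i => (invmx M *m (delta_mx 0 i : TG)^T)^T) => x i.
by rewrite omegaE trmxK mulmxA mulmxK // trmx_delta -colE mxE.
Qed.

(** The components of a smooth field in a left invariant frame are obtained by
    pairing it with the dual frame, and the form of two smooth fields is smooth;
    the expansion can thus be fed to the axioms of connections. *)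
Lemma nabla_frame : exists E F : 'I_n -> TG, forall X Y, smooth_vf X -> smooth_vf Y ->
  forall p, nabla X Y p = \sum_i omega p (X p) ((F i)^l p) *: nabla (E i)^l Y p.
Proof.
have [F FE] := form_dual_basis.
exists (fun i => delta_mx 0 i), F => X Y Xs Ys p.
pose f i := eval2 omega X (F i)^l.
have fs i : smooth_fun (f i) by apply: (sympl_smooth symp) => //; exact: left_vf_smooth.
have XE : X = fun q => \sum_i f i q *: (delta_mx 0 i : TG)^l q.
  apply/funext => q; have [x Xx] := left_vf_onto q (X q).
  have xE : x^l q = \sum_i x 0 i *: (delta_mx 0 i : TG)^l q.
    rewrite {1}(row_sum_delta x) /left_invariant_vf /tangent_map linear_sum.
    by apply: eq_bigr => i _; rewrite linearZ.
  rewrite Xx xE; apply: eq_bigr => i _.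
  by rewrite /f /eval2 Xx form_left_vf FE.
suff nabla_sum (r : seq 'I_n) :
    nabla (fun q => \sum_(i <- r) f i q *: (delta_mx 0 i : TG)^l q) Y p =
    \sum_(i <- r) f i p *: nabla (delta_mx 0 i : TG)^l Y p.
  by rewrite {1}XE nabla_sum.
elim: r => [|i r IH].
  rewrite big_nil.
  have -> : (fun q => \sum_(i <- [::]) f i q *: (delta_mx 0 i : TG)^l q) =
      (fun q => (0 : R) *: Y q).
    by apply/funext => q; rewrite big_nil scale0r.
  by rewrite (conn_tensorial conn) ?scale0r //; exact: smooth_fun_cst.
rewrite big_cons -IH -(conn_tensorial conn) //; last exact: left_vf_smooth.
rewrite -(conn_addl conn) //.
- by congr (nabla _ Y p); apply/funext => q; rewrite big_cons.
- by apply: smooth_vfZ => //; exact: left_vf_smooth.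
- by apply: smooth_vf_sum => // k; exact: left_vf_smooth.
Qed.

Lemma nabla_pointwise X X' Y p : smooth_vf X -> smooth_vf X' -> smooth_vf Y ->
  X p = X' p -> nabla X Y p = nabla X' Y p.
Proof.
have [E [F nablaE]] := nabla_frame.
by move=> Xs X's Ys XX'; rewrite !nablaE // XX'.
Qed.

Let ls := @left_vf_smooth R n G.
Let rs := @right_vf_smooth R n G.

Let right_left1 x : x^r 1%g = x^l 1%g.
Proof. by rewrite left_vf1 right_vf1. Qed.

Lemma nabla_zero Y p : smooth_vf Y -> nabla (fun=> 0) Y p = 0.
Proof.
move=> Ys; have -> : (fun=> 0) = (fun q => (0 : R) *: Y q).
  by apply/funext => q; rewrite scale0r.
by rewrite (conn_tensorial conn) ?scale0r //; exact: smooth_fun_cst.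
Qed.

Lemma nabla_left_left x y : nabla x^l y^l = (x ** y)^l.
Proof.
apply/funext => h.
have := sk_conn_left_invariant sk h (ls x) (ls y) h.
by rewrite /= !pushforward_left_vf /pushforward /ltrans mulVg => <-.
Qed.

(** The two fields commute, and there is no torsion. *)
Lemma nabla_left_right x z : nabla z^l x^r = nabla x^r z^l.
Proof.
apply/funext => p; apply/eqP; rewrite -subr_eq0.
by rewrite (sk_torsion_free sk (ls z) (rs x)) lie_bracket_left_right.
Qed.

Lemma nabla_flat_commute X Y Z p : smooth_vf X -> smooth_vf Y -> smooth_vf Z ->
  (forall q, lie_bracket X Y q = 0) ->
  nabla X (nabla Y Z) p = nabla Y (nabla X Z) p.
Proof.
move=> Xs Ys Zs XY; apply/eqP; rewrite -subr_eq0; have := sk_flat sk Xs Ys Zs p.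
have -> : lie_bracket X Y = fun=> 0 by apply/funext.
by rewrite nabla_zero // subr0 => ->.
Qed.

Lemma product_form_skew x y z : omega1 (x ** y) z + omega1 y (x ** z) = 0.
Proof.
have := sk_nabla_form sk (ls x) (ls y) (ls z) 1%g.
have -> : eval2 omega y^l z^l = fun=> omega1 y z.
  by apply/funext => p; exact: form_left_vf.
by rewrite vf_apply_cst /eval2 !left_vf1 => <-.
Qed.

Lemma product_endo x y :
  x ** (J 1%g y) - J 1%g (x ** y) = y ** (J 1%g x) - J 1%g (y ** x).
Proof.
have := sk_nabla_endo sk (ls x) (ls y) 1%g.
by rewrite /nabla_endo !endo_left_vf.
Qed.

Section BiInvariant.
Hypothesis bi_inv : bi_invariant nabla.

(** Both sides are right invariant. At the identity, the direction [x^r] may be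
    replaced with [x^l], which has the same value there; [nabla_left_right] then
    exchanges the arguments, and [y^r] is replaced with [y^l] in the same way. *)
Lemma nabla_right_right x y : nabla x^r y^r = (y ** x)^r.
Proof.
have at1 : nabla x^r y^r 1%g = y ** x.
  rewrite (nabla_pointwise (rs x) (ls x) (rs y) (right_left1 x)).
  rewrite nabla_left_right.
  exact: nabla_pointwise (rs y) (ls y) (ls x) (right_left1 y).
apply/funext => h.
have := bi_inv.2 h _ _ (rs x) (rs y) h.
by rewrite /= !pushforward_right_vf /pushforward /rtrans mulgV at1 => <-.
Qed.

(** Associativity is flatness applied to left and right invariant fields, which
    commute. Writing [x^l] and [x^r] for them, at the identity:
    [(y ** x) ** z = nabla z^l (nabla x^r y^r) = nabla x^r (nabla z^l y^r)
    = nabla x^l (nabla y^r z^l) = nabla y^r (nabla x^l z^l) = y ** (x ** z)]. *)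
Lemma product_assoc x y z : (y ** x) ** z = y ** (x ** z).
Proof.
have sm := conn_smooth conn.
have comm (u v : TG) q : lie_bracket u^l v^r q = 0 := lie_bracket_left_right u v q.
have e1 : nabla (y ** x)^r z^l 1%g = (y ** x) ** z :=
  nabla_pointwise (rs _) (ls _) (ls z) (right_left1 (y ** x)).
have e2 : nabla (y ** x)^r z^l 1%g = nabla z^l (nabla x^r y^r) 1%g :=
  etrans (congr1 (@^~ 1%g) (esym (nabla_left_right (y ** x) z)))
    (congr1 (fun Y => nabla z^l Y 1%g) (esym (nabla_right_right x y))).
have e3 : nabla z^l (nabla x^r y^r) 1%g = nabla x^r (nabla z^l y^r) 1%g :=
  nabla_flat_commute _ (ls z) (rs x) (rs y) (comm z x).
have e4 : nabla x^r (nabla z^l y^r) 1%g = nabla x^l (nabla z^l y^r) 1%g :=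
  nabla_pointwise (rs x) (ls x) (sm _ _ (ls z) (rs y)) (right_left1 x).
have e5 : nabla x^l (nabla y^r z^l) 1%g = nabla y^r (nabla x^l z^l) 1%g :=
  nabla_flat_commute _ (ls x) (rs y) (ls z) (comm x y).
have e6 : nabla y^r (x ** z)^l 1%g = y ** (x ** z) :=
  nabla_pointwise (rs y) (ls y) (ls _) (right_left1 y).
have e45 : nabla x^l (nabla z^l y^r) 1%g = nabla x^l (nabla y^r z^l) 1%g :=
  congr1 (fun Y => nabla x^l Y 1%g) (nabla_left_right y z).
have e56 : nabla y^r (nabla x^l z^l) 1%g = nabla y^r (x ** z)^l 1%g :=
  congr1 (fun Y => nabla y^r Y 1%g) (nabla_left_left x z).
have e234 := etrans (etrans e2 e3) e4.
have e456 := etrans (etrans e45 e5) (etrans e56 e6).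
exact: etrans (esym e1) (etrans e234 e456).
Qed.

Hypothesis pos : metric_positive_definite omega J.

Lemma invariant_product_zero x y : x ** y = 0.
Proof.
apply: (@product_vanishes _ _ omega1 (J 1%g) (fun x y => x ** y)).
- exact: sympl_linl.
- exact: sympl_linr.
- exact: sympl_alt.
- exact: sympl_nondeg.
- by have := cplx_lin (sk_complex sk) 1%g (-1) 0 0; rewrite scaler0 addr0 scaleN1r addNr.
- exact: (sk_metric_sym sk).
- exact: pos.
- by move=> *; exact: product_assoc.
- exact: product_form_skew.
- exact: product_endo.
Qed.

Lemma nabla_left_zero X z p : smooth_vf X -> nabla X z^l p = 0.
Proof.
move=> Xs; have [x Xx] := left_vf_onto p (X p).
rewrite (nabla_pointwise _ _ _ Xx) // nabla_left_left invariant_product_zero.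
by rewrite /left_invariant_vf tangent_map0.
Qed.

(** As [nabla_(y^l) x^r = nabla_(x^r) y^l = 0], the function [omega x^r z^l] has
    zero derivative, and its value is read at the identity. *)
Lemma right_vf_eq_left x p : x^r p = x^l p.
Proof.
apply/eqP; rewrite -subr_eq0; apply/eqP.
apply: (@sympl_nondeg _ _ _ _ symp p) => v.
have [z ->] := left_vf_onto p v.
have cst_form : omega p (x^r p) (z^l p) = omega1 (x^r 1%g) (z^l 1%g).
  apply: (@vf_zero_cst _ _ _ (eval2 omega x^r z^l)).
  - exact: sk_connected sk.
  - exact: (sympl_smooth symp (rs x) (ls z)).
  move=> y q.
  have n1 : nabla y^l x^r q = 0 :=
    etrans (congr1 (@^~ q) (nabla_left_right x y)) (nabla_left_zero y q (rs x)).
  have n2 : nabla y^l z^l q = 0 := nabla_left_zero z q (ls y).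
  apply: etrans (sk_nabla_form sk (ls y) (rs x) (ls z) q) _.
  rewrite /eval2 n1 n2.
  by rewrite (scalar0 (sympl_linl symp _ _)) (scalar0 (sympl_linr symp _ _)) addr0.
rewrite left_vf1 right_vf1 in cst_form.
have form_eq := etrans cst_form (esym (form_left_vf x z p)).
have subE := scalarB (sympl_linl symp p (z^l p)) (x^r p) (x^l p).
have diff0 : omega p (x^r p) (z^l p) - omega p (x^l p) (z^l p) = 0.
  by apply/eqP; rewrite subr_eq0; apply/eqP; exact: form_eq.
exact: etrans subE diff0.
Qed.

(** Since left and right translations have the same tangent map at the identity,
    the differential of [h |-> h^-1 * (g * h)] vanishes everywhere. *)
Lemma group_commutative g h : (g * h = h * g)%g.
Proof.
pose F k := (k^-1 * (g * k))%g.
have Fcst : forall p q, F q = F p.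
  apply: gdiff_zero_cst; first exact: sk_connected sk.
  move=> p; apply: filterS (gdiff_coord_inv_near p) => u [L Ld].
  set k := coord_inv p u in Ld *.
  have [M Md] := gdiff_inv Ld.
  have kk1 := gdiff_mul Md Ld.
  have kgk := gdiff_mul Md (gdiff_ltrans g Ld).
  (* differentiate [k^-1 * k = 1] to express [M] through [L] *)
  have kk0 : is_gdiff (fun w : TG => (coord_inv p w)^-1 * coord_inv p w)%g u (k^-1 * k)%g 0.
    rewrite mulVg; under eq_fun do rewrite mulVg; exact: gdiff_cst.
  have [kgkv kgkc kgkd] := kgk; split=> //.
  apply: is_diff_eq kgkd _; apply/funext => w /=.
  have [x Lx] := left_vf_onto k (L w).
  have Lk : tangent_map (ltrans k^-1%g) k (L w) = x.
    rewrite Lx; apply: etrans (left_vf_translate k^-1%g k x) _.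
    by rewrite mulVg; exact: left_vf1.
  have Mk : tangent_map (rtrans k) k^-1%g (M w) = - x.
    have := congr1 (@^~ w) (gdiff_unique kk1 kk0).
    by rewrite /= Lk => /eqP; rewrite addr_eq0 => /eqP.
  have Mw : M w = - x^r k^-1%g.
    have E := tangent_rtransM k^-1%g k k^-1%g (M w).
    have E1 : tangent_map (rtrans (k * k^-1)%g) k^-1%g (M w) = M w.
      by rewrite mulgV; exact: tangent_rtrans1.
    have E2 : tangent_map (rtrans k^-1%g) (k^-1 * k)%g
        (tangent_map (rtrans k) k^-1%g (M w)) = - x^r k^-1%g.
      by rewrite Mk mulVg; exact: tangent_mapN.
    exact: etrans (esym E1) (etrans (esym E) E2).
  have T1 : tangent_map (rtrans (g * k)%g) k^-1%g (M w) = - x^r (k^-1 * (g * k))%g.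
    rewrite Mw; apply: etrans (tangent_mapN _ _ _) _.
    exact: (congr1 (fun v => - v) (right_vf_translate (g * k)%g k^-1%g x)).
  have T2 : tangent_map (ltrans k^-1%g) (g * k)%g (tangent_map (ltrans g) k (L w)) =
      x^l (k^-1 * (g * k))%g.
    rewrite Lx; apply: etrans (left_vf_translate k^-1%g (g * k)%g x).
    exact: (congr1 (tangent_map (ltrans k^-1%g) (g * k)%g) (left_vf_translate g k x)).
  have T3 := right_vf_eq_left x (k^-1 * (g * k))%g.
  rewrite T1 T2 T3; exact: addNr.
have := Fcst 1%g h.
rewrite /F invg1 mul1g mulg1 => E.
by rewrite -{2}E [RHS]mulgA mulgV mul1g.
Qed.

(** Test against the parallel fields [z^l]: as [J] is skew for the form and
    [J z^l] is again left invariant, both terms are the derivative along [X] of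
    the function [omega (J Y) z^l]. *)
Lemma nabla_endo_zero : endo_parallel nabla J.
Proof.
move=> X Y Xs Ys p.
have linl q v := sympl_linl symp q v; have linr q u := sympl_linr symp q u.
have omegaC q := alternating_antisym (sympl_linl symp q) (sympl_linr symp q) (sympl_alt symp q).
have J_adj q u z : omega q (J q u) (z^l q) = omega q u ((- J 1%g z)^l q).
  rewrite omegaC -[omega q (z^l q) (J q u)]/(metric omega J q _ _).
  rewrite (sk_metric_sym sk) /metric -[J q (z^l q)]/(eval1 J z^l q) endo_left_vf.
  by rewrite /left_invariant_vf /tangent_map linearN (scalarN (linr _ _)).
have JY := cplx_smooth (sk_complex sk) Ys.
apply: (@sympl_nondeg _ _ _ _ symp p) => v; have [z ->] := left_vf_onto p v.
rewrite (scalarB (linl _ _)) J_adj.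
have nabla_z (Z : G -> TG) w : smooth_vf Z ->
    omega p (nabla X Z p) (w^l p) = vf_apply X (eval2 omega Z w^l) p.
  move=> Zs; rewrite (sk_nabla_form sk) // /eval2 nabla_left_zero //.
  by rewrite (scalar0 (linr _ _)) addr0.
rewrite !nabla_z //.
have -> : eval2 omega (eval1 J Y) z^l = eval2 omega Y (- J 1%g z)^l.
  by apply/funext => q; exact: J_adj.
by rewrite subrr.
Qed.

Lemma lie_bracket_zero x y : lie_bracket x^l y^l 1%g = 0.
Proof. by rewrite -(sk_torsion_free sk (ls x) (ls y)) !invariant_product_zero subrr. Qed.

End BiInvariant.
End SpecialKahlerGroup.

(** * Double extensions and nilpotency *)

Section FlatAlgebras.
Context {R : realType}.

(** With zero product and zero bracket, all that remains is a positive definite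
    Hermitian space. *)
Record is_flat_hermitian (A : skAlgebra R) : Prop := {
  fh_br : forall x y : A, sk_br x y = 0;
  fh_mul : forall x y : A, sk_mul x y = 0;
  fh_linl : forall y : A, scalar (sk_form ^~ y);
  fh_linr : forall x : A, scalar (sk_form x);
  fh_alt : forall x : A, sk_form x x = 0;
  fh_j_lin : linear (sk_j : A -> A);
  fh_j_sqr : forall x : A, sk_j (sk_j x) = - x;
  fh_sym : forall x y : A, sk_form x (sk_j y) = sk_form y (sk_j x);
  fh_pos : forall x : A, x != 0 -> 0 < sk_form x (sk_j x)
}.

Lemma flat_hermitian_nondeg (A : skAlgebra R) : is_flat_hermitian A ->
  forall x : A, (forall y, sk_form x (sk_j y) = 0) -> x = 0.
Proof.
move=> fA x x0; apply/eqP/negPn/negP => /(fh_pos fA).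
by rewrite x0 ltxx.
Qed.

Lemma flat_hermitian_special_kahler (A : skAlgebra R) :
  is_flat_hermitian A -> is_special_kahler_algebra A.
Proof.
move=> fA; have [br0 mul0 linl linr alt jlin jsqr jsym jpos] := fA.
have j0 : sk_j (0 : A) = 0.
  by have := jlin (-1) 0 0; rewrite scaler0 addr0 scaleN1r addNr.
have nondeg := flat_hermitian_nondeg fA.
split=> //.
- by move=> y a u v; rewrite !br0 scaler0 addr0.
- by move=> x a u v; rewrite !br0 scaler0 addr0.
- by move=> x y z; rewrite !br0 !addr0.
- by move=> x x0; apply: nondeg => y; exact: x0.
- by move=> x y z; rewrite !br0 !(scalar0 (linl _)) !addr0.
- by move=> x y; rewrite !br0 !j0 !subr0.
- by move=> y a u v; rewrite !mul0 scaler0 addr0.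
- by move=> x a u v; rewrite !mul0 scaler0 addr0.
- by move=> x y z; rewrite !mul0.
- by move=> x y; rewrite br0 !mul0 subr0.
- by move=> x y z; rewrite !mul0 (scalar0 (linl _)) (scalar0 (linr _)) addr0.
- by move=> x y; rewrite br0 !mul0 j0 subr0.
Qed.

Section Reduction.
Variables (A : skAlgebra R) (fA : is_flat_hermitian A) (e : A).
Hypothesis e_unit : sk_form e (sk_j e) = 1.
Let d : A := sk_j e.

Let linl := fh_linl fA.
Let linr := fh_linr fA.
Let formM (x : A) := GRing.isLinear.Build R A R^o *:%R (sk_form x) (linr x).
Let formL (x : A) : {linear A -> R^o} := HB.pack (sk_form x : A -> R^o) (formM x).
Let formC := alternating_antisym linl linr (fh_alt fA).

Definition hermitian_complement : {vspace A} :=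
  (lker (linfun (formL e)) :&: lker (linfun (formL d)))%VS.
Local Notation U := hermitian_complement.

Lemma hermitian_complementP x :
  reflect (sk_form e x = 0 /\ sk_form d x = 0) (x \in U).
Proof.
rewrite memv_cap !memv_ker !lfunE /=.
by apply: (iffP andP) => -[/eqP ? /eqP ?].
Qed.

Lemma hermitian_complement_stable x : x \in U -> sk_j x \in U.
Proof.
move=> /hermitian_complementP[ex dx]; apply/hermitian_complementP; split.
  by rewrite (fh_sym fA) formC dx oppr0.
by rewrite (fh_sym fA) (fh_j_sqr fA) (scalarN (linr _)) formC opprK.
Qed.

Definition complement_algebra : skAlgebra R :=
  @SkAlgebra R (subvs_of U) (fun _ _ => 0) (fun x y => sk_form (vsval x) (vsval y))
    (fun x => vsproj U (sk_j (vsval x))) (fun _ _ => 0).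

Let vsval_j (x : complement_algebra) : vsval (sk_j x) = sk_j (vsval x).
Proof. by rewrite /= vsprojK // hermitian_complement_stable // subvsP. Qed.

Let vsvalP (a : R) (u v : subvs_of U) : vsval (a *: u + v) = a *: vsval u + vsval v.
Proof. exact: linearP. Qed.

Let dE (x : A) : sk_form x d = - sk_form d x. Proof. exact: formC. Qed.

Lemma complement_flat_hermitian : is_flat_hermitian complement_algebra.
Proof.
split=> //.
- by move=> y a u v; have := linl (vsval y) a (vsval u) (vsval v); rewrite -vsvalP.
- by move=> x a u v; have := linr (vsval x) a (vsval u) (vsval v); rewrite -vsvalP.
- by move=> x; exact: (fh_alt fA (vsval x)).
- move=> a u v; apply: subvs_inj; rewrite vsval_j [in RHS]vsvalP !vsval_j.
  by rewrite [X in sk_j X]vsvalP; exact: (fh_j_lin fA).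
- move=> x; apply: subvs_inj; rewrite !vsval_j (fh_j_sqr fA); exact/esym/linearN.
- move=> x y; apply: etrans (congr1 (sk_form (vsval x)) (vsval_j y)) _.
  apply: etrans (fh_sym fA _ _) _.
  exact: (esym (congr1 (sk_form (vsval y)) (vsval_j x))).
- move=> x x0; have vx0 : vsval x != 0.
    by apply: contra x0 => /eqP x0; apply/eqP/subvs_inj; rewrite x0 linear0.
  by have := fh_pos fA vx0; rewrite -(vsval_j x).
Qed.

(** The plane spanned by [e] and [j e] is a symplectic summand stable under [j];
    the map is the sum, and its inverse reads the two coordinates off the form. *)
Lemma complement_iso :
  sk_isomorphic (@double_ext R complement_algebra (fun=> 0)) A.
Proof.
have ee : sk_form e e = 0 := fh_alt fA e.
have dd : sk_form d d = 0 := fh_alt fA d.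
have ed : sk_form e d = 1 := e_unit.
have de : sk_form d e = - 1 by rewrite formC ed.
have formD (x y z : A) : sk_form x (y + z) = sk_form x y + sk_form x z.
  by rewrite -{1}[z]opprK (scalarB (linr x)) (scalarN (linr x)) opprK.
pose f (s : R^o * subvs_of U * R^o) : A := s.1.1 *: e + vsval s.1.2 + s.2 *: d.
have form_e s : sk_form e (f s) = s.2.
  have /hermitian_complementP[ex _] := subvsP s.1.2.
  by rewrite /f !formD !(scalar_scale (linr _)) ee ed ex mulr0 mulr1 !add0r.
have form_d s : sk_form d (f s) = - s.1.1.
  have /hermitian_complementP[_ dx] := subvsP s.1.2.
  by rewrite /f !formD !(scalar_scale (linr _)) de dd dx mulr0 mulrN1 !addr0.
pose rest (y : A) := y + sk_form d y *: e - sk_form e y *: d.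
have restU y : rest y \in U.
  apply/hermitian_complementP; rewrite !(scalarB (linr _)) !formD.
  by rewrite !(scalar_scale (linr _)) ee ed de dd; split; ring.
pose g (y : A) : R^o * subvs_of U * R^o :=
  (- sk_form d y, vsproj U (rest y), sk_form e y).
have flin : linear f.
  move=> a [[s1 s2] s3] [[t1 t2] t3].
  rewrite -[LHS]/((a * s1 + t1) *: e + vsval (a *: s2 + t2) + (a * s3 + t3) *: d).
  rewrite vsvalP -[RHS]/(a *: (s1 *: e + vsval s2 + s3 *: d) +
    (t1 *: e + vsval t2 + t3 *: d)).
  rewrite !scalerDl !scalerDr !scalerA [RHS]addrACA; congr (_ + _).
  exact: addrACA.
have f0 (v : subvs_of U) : v = 0 -> f (0, v, 0) = 0.
  by move=> ->; rewrite /f /= !scale0r add0r addr0.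
exists f; split=> //.
- exists g => [s|y].
    rewrite /g form_e form_d opprK /rest form_e form_d; case: s => [[a x] b] /=.
    congr (_, _, _); rewrite -[RHS]vsvalK; congr vsproj.
    by rewrite /f /= scaleNr addrAC addrK addrC addKr.
  by rewrite /f /g /= vsprojK // /rest scaleNr addrA subrK addrC addrK.
- move=> [[a x] b] [[a' y] b']; rewrite (fh_br fA); apply: f0.
  by rewrite !scaler0 subr0 addr0.
split.
- move=> [[a x] b] [[a' y] b'].
  have xy : sk_form (f (a, x, b)) (vsval y) = sk_form (vsval x) (vsval y).
    have /hermitian_complementP[ey dy] := subvsP y.
    rewrite formC {1}/f !formD !(scalar_scale (linr _)) /=.
    by rewrite dE dy (formC _ e) ey !oppr0 !mulr0 add0r addr0 -formC.
  rewrite {2}/f !formD !(scalar_scale (linr _)) /= xy.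
  rewrite (formC _ e) form_e dE form_d opprK /=.
  rewrite -[RHS]/(sk_form (vsval x) (vsval y) + (a * b' - b * a')).
  ring.
- move=> [[a x] b].
  rewrite -[LHS]/(- b *: e + vsval (vsproj U (sk_j (vsval x))) + a *: d).
  rewrite vsprojK; last by rewrite hermitian_complement_stable // subvsP.
  have jE : sk_j (a *: e + vsval x + b *: d) =
      b *: sk_j d + (a *: sk_j e + sk_j (vsval x)).
    rewrite addrC; apply: etrans (fh_j_lin fA b d _) _; congr (_ + _).
    exact: fh_j_lin.
  rewrite -[RHS]/(sk_j (a *: e + vsval x + b *: d)) jE.
  by rewrite (fh_j_sqr fA) scalerN scaleNr -addrA [X in _ + X]addrC.
- move=> [[a x] b] [[a' y] b']; rewrite (fh_mul fA); apply: f0.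
  by rewrite scaler0 addr0.
Qed.

Lemma complement_dim_lt : (\dim U < \dim {:A})%N.
Proof.
rewrite ltn_neqAle dimvS ?subvf // andbT; apply/negP => dimU.
have Ufull : (U == fullv)%VS by rewrite eqEdim subvf /= leq_eqVlt eq_sym dimU.
have : d \in U by rewrite (eqP Ufull) memvf.
by move=> /hermitian_complementP[]; rewrite e_unit => /eqP; rewrite oner_eq0.
Qed.

End Reduction.

(** Normalize a nonzero vector and split off the complex line that it spans; the
    derivation of the double extension is zero. *)
Lemma flat_iterated_double_ext (A : skAlgebra R) :
  is_flat_hermitian A -> iterated_double_ext A.
Proof.
have [N] := ubnP (dim A); elim: N A => // N IH A dimA fA.
have [A0|/existsNP[x /eqP x0]] := pselect (forall x : A, x = 0).
  exact/Ide_zero/A0/flat_hermitian_special_kahler.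
have pos := fh_pos fA x0.
pose r := (Num.sqrt (sk_form x (sk_j x)))^-1.
have e_unit : sk_form (r *: x) (sk_j (r *: x)) = 1.
  have -> : sk_j (r *: x) = r *: sk_j x.
    have j0 : sk_j (0 : A) = 0.
      by have := fh_j_lin fA (-1) 0 0; rewrite scaler0 addr0 scaleN1r addNr.
    by have := fh_j_lin fA r x 0; rewrite j0 !addr0.
  rewrite (scalar_scale (fh_linl fA _)) (scalar_scale (fh_linr fA _)).
  rewrite mulrA -expr2 exprVn sqr_sqrtr ?ltW // mulVf // gt_eqF //.
have fB := complement_flat_hermitian fA (r *: x).
have dim_lt := complement_dim_lt fA e_unit; rewrite dimvf in dim_lt.
have dimB : (dim (complement_algebra fA (r *: x)) < N)%N.
  exact: leq_trans dim_lt dimA.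
have itB := IH _ dimB fB.
apply: (Ide_step (flat_hermitian_special_kahler fB) itB _ (complement_iso fA e_unit)).
split.
- by move=> a u v; rewrite scaler0 addr0.
- by move=> u v; rewrite (scalar0 (fh_linl fB _)) (scalar0 (fh_linr fB _)) addr0.
- by move=> u v; rewrite addr0.
- move=> u; have := fh_j_lin fB (-1) 0 0.
  by rewrite scaler0 addr0 scaleN1r addNr => ->.
Qed.

End FlatAlgebras.

Lemma commutative_group_nilpotent (G : groupType) :
  (forall g h : G, (g * h = h * g)%g) -> nilpotent_group G.
Proof.
move=> GC; exists 1%N; apply/seteqP; split => [z Gz|z ->].
  apply: Gz; split; last first.
    by move=> _ [x _ [y ->]]; apply/eqP/commgP; exact: GC.
  by split=> [|x y -> ->|x ->] //=; rewrite ?mulg1 ?invg1.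
by move=> H [[]].
Qed.

Theorem corollary5p10 (R : realType) (n : nat) (G : lieGroup R n)
    (omega : G -> 'rV[R]_n -> 'rV[R]_n -> R)
    (J : G -> 'rV[R]_n -> 'rV[R]_n)
    (nabla : (G -> 'rV[R]_n) -> (G -> 'rV[R]_n) -> (G -> 'rV[R]_n)) :
  is_special_kahler_lie_group omega J nabla ->
  metric_positive_definite omega J ->
  bi_invariant nabla ->
  [/\ nilpotent_group G,
      iterated_double_ext (lie_group_algebra omega J nabla)
    & endo_parallel nabla J].
Proof.
move=> sk pos bi_inv; split.
- exact/commutative_group_nilpotent/(group_commutative sk bi_inv pos).
- apply: flat_iterated_double_ext.
  have symp := sk_symplectic sk; have cplx := sk_complex sk.
  split.
  + exact: (lie_bracket_zero sk bi_inv pos).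
  + exact: (invariant_product_zero sk bi_inv pos).
  + exact: (sympl_linl symp 1%g).
  + exact: (sympl_linr symp 1%g).
  + exact: (sympl_alt symp 1%g).
  + exact: (cplx_lin cplx 1%g).
  + exact: (cplx_sqr cplx 1%g).
  + exact: (sk_metric_sym sk 1%g).
  + exact: (pos 1%g).
- exact: (nabla_endo_zero sk bi_inv pos).
Qed.
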